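(* Let $\mathcal X,\mathcal Y$ be real separable Hilbert spaces, $1\le p<\infty$, $B,L>0$, $\sigma>0$, and let $\mu$ be a probability measure on $\mathcal X$ satisfying conditions (i), (ii), (iii-L), (iii-U) of the context. Suppose the noise is Hilbert-valued Gaussian noise and that the eigenvalues of the covariance operator of $\mu$ are $\lambda_i=\exp(-\tau i^{\omega})$, $i\in\mathbb N$, for some $\tau>0$ and $\omega\ge1$. Then $$\mathcal L_m(\mathcal F_{B,L};L^p_\mu)\asymp_{\tau,\omega,\iota,p}\bigl(\log(m/\sigma^2)\bigr)^{\frac{\omega}{\omega+1}},\qquad m\to\infty,$$ where $\mathcal L_m(\mathcal F_{B,L};L^p_\mu)=-\log(\mathcal M_m(\mathcal F_{B,L};L^p_\mu))$ and $\mathcal M_m$ is either the fixed-design or the random-design minimax risk.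
   Context: Conditions on $\mu$ (a Borel probability measure on $\mathcal X$): (i) $\mu$ has mean zero and $\int_{\mathcal X}\|X\|_{\mathcal X}^2\,d\mu(X)<\infty$. (ii) Let $\lambda_1\ge\lambda_2\ge\cdots>0$ and $\{\phi_i\}_i\subset\mathcal X$ be the eigenvalues and an orthonormal basis of eigenvectors of the covariance operator of $\mu$. The real random variables $\xi_i=\langle X,\phi_i\rangle_{\mathcal X}/\sqrt{\lambda_i}$, $X\sim\mu$, are independent. (iii-L) Each $\xi_i$ has a density $\nu_i$ with respect to Lebesgue measure, and there are constants $a,b>0$ (independent of $i$) with $\nu_i(x)\ge b$ for all $|x|\le a$ and all $i$. Put $\iota=2ab\le1$. (iii-U) With $p'=\max\{p,2\}$, $\sup_i(\mathbb E|\xi_i|^{p'})^{1/p'}<\infty$. Observations: $Y_i=F(X_i)+\sigma E_i$, $i=1,\dots,m$. Hilbert-valued Gaussian noise: $E_1,\dots,E_m$ are i.i.d. mean-zero Gaussian random elements of $\mathcal Y$ with covariance operator $\Upsilon$, $\mathrm{Tr}(\Upsilon)=1$. Class: $\mathcal F_{B,L}$ is the set of $F:\mathcal X\to\mathcal Y$ with $\|F(X)\|_{\mathcal Y}\le B$ and $\|F(X)-F(X')\|_{\mathcal Y}\le L\|X-X'\|_{\mathcal X}$ for all $X,X'\in\mathcal X$. Norm: $\|F\|_{L^p_\mu(\mathcal X;\mathcal Y)}=(\int_{\mathcal X}\|F(X)\|_{\mathcal Y}^p\,d\mu(X))^{1/p}$. Minimax risks: an estimator $\widehat F$ is a mapping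 from the data to $L^p_\mu(\mathcal X;\mathcal Y)$. Fixed design: $\mathcal M_m(\mathcal F;L^p_\mu)=\inf_{\mathcal D}\inf_{\widehat F}\sup_{F\in\mathcal F}\mathbb E\|F-\widehat F\|_{L^p_\mu(\mathcal X;\mathcal Y)}$, with infimum over designs $\mathcal D=\{X_1,\dots,X_m\}\subset\mathcal X$ and expectation over the $E_i$. Random design: $\mathcal M_m(\mathcal F;L^p_\mu)=\inf_\nu\inf_{\widehat F}\sup_{F\in\mathcal F}\mathbb E\|F-\widehat F\|_{L^p_\mu(\mathcal X;\mathcal Y)}$, with infimum over probability measures $\nu$ on $\mathcal X$, $X_1,\dots,X_m$ i.i.d. from $\nu$ independent of the $E_i$, and expectation over the $X_i$ and $E_i$. Asymptotic notation: $A(m)\lesssim_r A'(m)$ as $m\to\infty$ means there is a constant $c(r)>0$ depending only on the parameters $r$ such that $A(m)\le c(r)A'(m)$ for all sufficiently large $m$ (the threshold may depend on all fixed data); $A\asymp_r A'$ means $A\lesssim_r A'$ and $A'\lesssim_r A$. *)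

(* Defs.v *)
From HB Require Import structures.
From mathcomp Require Import all_boot all_order all_algebra finmap.
From mathcomp Require Import all_classical all_reals all_analysis.

Set Implicit Arguments.
Unset Strict Implicit.
Unset Printing Implicit Defensive.

Import Order.TTheory GRing.Theory Num.Theory.
Import numFieldNormedType.Exports.

Local Open Scope classical_set_scope.
Local Open Scope ring_scope.

HB.mixin Record NormedModule_isHilbert (R : realType) V
    of CompleteNormedModule R V := {
  inner : V -> V -> R;
  innerC : forall x y, inner x y = inner y x;
  innerDl : forall x y z, inner (x + y) z = inner x z + inner y z;
  innerZl : forall (c : R) x y, inner (c *: x) y = c * inner x y;
  inner_norm : forall x, inner x x = `|x| ^+ 2 }.

#[short(type="hilbertType")]
HB.structure Definition Hilbert (R : realType) :=
  {V of NormedModule_isHilbert R V & CompleteNormedModule R V}.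

Notation borel V := (g_sigma_algebraType (@open V)).

Section hilbert.
Context {R : realType} {V : hilbertType R}.
Implicit Types (mu : probability (borel V) R) (C : V -> V).

Definition separable := exists D : set V, countable D /\ dense D.

Definition linear_span (A : set V) : set V :=
  [set v | exists n (e : 'I_n -> V) (c : 'I_n -> R),
    (forall i, A (e i)) /\ v = \sum_(i < n) c i *: e i].

Definition orthonormal_basis (I : choiceType) (e : I -> V) :=
  (forall i j, inner (e i) (e j) = (i == j)%:R) /\
  closure (linear_span (range e)) = [set: V].

(* The index type is arbitrary because V may have finite dimension. The sum is
   a sum of nonnegative terms when A is a covariance operator. *)
Definition has_trace (A : V -> V) (t : R) :=
  exists (I : choiceType) (e : I -> V), orthonormal_basis e /\
    (\esum_(i in [set: I]) (inner (A (e i)) (e i))%:E = t%:E)%E.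

(* The mean and the covariance operator of a law with finite second moment are
   given by their action on the functionals <., y>. *)
Definition has_mean mu (a : V) :=
  forall y, ('E_mu[fun x => inner x y] = (inner a y)%:E)%E.

Definition covariance_operator mu C :=
  forall y z, covariance mu (fun x => inner x y) (fun x => inner x z)
              = (inner (C y) z)%:E.

(* [normal_prob m 0] is not a Dirac mass in the library, hence the case s = 0 *)
Definition normal_or_dirac (m s : R) : set R -> \bar R :=
  if s == 0 then dirac m else normal_prob m s.

Definition gaussian mu := forall y : V, exists m s : R,
  forall A : set R, measurable A ->
    mu ((fun x => inner x y) @^-1` A) = normal_or_dirac m s A.

Definition gaussian_noise mu := exists Upsilon : V -> V,
  [/\ gaussian mu, has_mean mu 0, covariance_operator mu Upsilon
    & has_trace Upsilon 1].

End hilbert.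
Arguments separable {R} V.

Definition independent_seq d (T : measurableType d) (R : realType)
    (P : probability T R) (xi : nat -> T -> R) :=
  forall (J : {fset nat}) (A : nat -> set R), (forall i, measurable (A i)) ->
    (P (\bigcap_(i in [set` J]) (xi i @^-1` A i))
     = \prod_(i <- J) P (xi i @^-1` A i))%E.

Definition has_density d (T : measurableType d) (R : realType)
    (P : probability T R) (xi : T -> R) (f : R -> R) :=
  [/\ measurable_fun setT f, (forall x, 0 <= f x) &
    forall A : set R, measurable A ->
      (P (xi @^-1` A) = \int[lebesgue_measure]_(x in A) (f x)%:E)%E].

(* m-fold product of a probability measure, the law of m i.i.d. draws *)
Section iid.
Context d {T : measurableType d} {R : realType}.

Let cons_pair m (x : T * m.-tuple T) : m.+1.-tuple T :=
  [the m.+1.-tuple T of x.1 :: x.2].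

Let measurable_cons_pair m : measurable_fun setT (@cons_pair m).
Proof. by apply: measurable_cons; [exact: measurable_fst|exact: measurable_snd]. Qed.

HB.instance Definition _ m :=
  isMeasurableFun.Build _ _ _ _ (@cons_pair m) (@measurable_cons_pair m).

Fixpoint iid (P : probability T R) (m : nat) : probability (m.-tuple T) R :=
  match m with
  | 0 => \d_([tuple] : 0.-tuple T)
  | m'.+1 => distribution (P \x iid P m')%E (@cons_pair m')
  end.

Lemma iidE (P : probability T R) m (A : 'I_m -> set T) :
  (forall i, measurable (A i)) ->
  (iid P m [set t | forall i, A i (tnth t i)] = \prod_(i < m) P (A i))%E.
Proof.
elim: m A => [|m IHm] A mA /=.
  by rewrite big_ord0 diracE mem_set // => -[].
rewrite /distribution /pushforward big_ord_recl -IHm; last first.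
  by move=> i; exact: mA.
rewrite -product_measure1E //; last first.
  rewrite (_ : mkset _ =
    \bigcap_(i in [set: 'I_m]) ((fun t => tnth t i) @^-1` A (lift ord0 i))).
    apply: fin_bigcap_measurable; first exact: finite_finset.
    move=> i _; rewrite -[X in measurable X]setTI.
    exact: (@measurable_tnth _ T m i measurableT).
  by apply/seteqP; split => [t tA i _|t tA i] /=; [exact: tA|exact: (tA i I)].
congr (_ _); apply/seteqP; split=> -[x t] /=.
  move=> xtA; split => /= [|i]; first exact: (xtA ord0).
  by have := xtA (lift ord0 i); rewrite tnthS.
move=> [/= xA tA] i; case: (unliftP ord0 i) => [j|] -> //.
by rewrite tnthS.
Qed.

End iid.

Section minimax.
Context {R : realType} {X Y : hilbertType R}.
Variable mu : probability (borel X) R.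
Implicit Types (F G H : X -> Y) (B L p sigma : R).

Definition cond_i :=
  has_mean mu 0 /\ (\int[mu]_x (`|x : X| ^+ 2)%:E < +oo)%E.

(* Sequences are indexed from 0: [lam i] and [phi i] stand for lambda_(i+1) and
   phi_(i+1). *)
Definition xi (lam : nat -> R) (phi : nat -> X) (i : nat) (x : X) : R :=
  inner x (phi i) / Num.sqrt (lam i).

Definition cond_ii (lam : nat -> R) (phi : nat -> X) :=
  [/\ (forall i, 0 < lam i /\ lam i.+1 <= lam i),
      orthonormal_basis phi,
      (exists C : X -> X, covariance_operator mu C /\
         forall i, C (phi i) = lam i *: phi i) &
      independent_seq mu (xi lam phi)].

Definition cond_iii_lower (lam : nat -> R) (phi : nat -> X) (a b : R) :=
  [/\ 0 < a, 0 < b & exists nu : nat -> R -> R, forall i,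
    has_density mu (xi lam phi i) (nu i) /\
    forall x, `|x| <= a -> b <= nu i x].

Definition cond_iii_upper (lam : nat -> R) (phi : nat -> X) p :=
  (ereal_sup (range (fun i =>
     'N[mu]_((Num.max p 2)%:E)[EFin \o xi lam phi i])) < +oo)%E.

Definition lip_class B L : set (X -> Y) :=
  [set F | (forall x, `|F x| <= B) /\
           (forall x x', `|F x - F x'| <= L * `|x - x'|)].

Definition bochner_norm p F : \bar R :=
  ('N[mu]_(p%:E)[EFin \o (@Num.norm R Y \o F)])%E.

(* Elements of L^p_mu(X; Y) are handled through representatives. *)
Definition bochner_space p : set (X -> Y) :=
  [set F | measurable_fun [set: borel X] (F : borel X -> borel Y) /\
           (bochner_norm p F < +oo)%E].

Definition bochner_open p (U : set (X -> Y)) :=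
  forall F, bochner_space p F -> U F -> exists2 r : R, 0 < r &
    forall G, bochner_space p G -> (bochner_norm p (G \- F)%R < r%:E)%E -> U G.

(* Borel measurable maps from the data space D to L^p_mu(X; Y) *)
Definition estimator p d (D : measurableType d) : set (D -> X -> Y) :=
  [set Fhat | (forall t, bochner_space p (Fhat t)) /\
    forall U, bochner_open p U -> measurable (Fhat @^-1` U)].

Definition responses m sigma F (x : m.-tuple (borel X))
    (e : m.-tuple (borel Y)) : m.-tuple (borel Y) :=
  [tuple F (tnth x i) + sigma *: (tnth e i : Y) | i < m].

Definition observations m sigma F (x : m.-tuple (borel X))
    (e : m.-tuple (borel Y)) : m.-tuple (borel X * borel Y)%type :=
  [tuple (tnth x i, tnth (responses sigma F x e) i) | i < m].

Variables (gamma : probability (borel Y) R) (sigma p : R).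

Definition fixed_design_risk (Fs : set (X -> Y)) (m : nat) : \bar R :=
  ereal_inf [set
    ereal_inf [set
      ereal_sup [set
        (\int[iid gamma m]_e
           bochner_norm p (F \- Fhat (responses sigma F x e))%R)%E
      | F in Fs]
    | Fhat in @estimator p _ (m.-tuple (borel Y))]
  | x in [set: m.-tuple (borel X)]].

Definition random_design_risk (Fs : set (X -> Y)) (m : nat) : \bar R :=
  ereal_inf [set
    ereal_inf [set
      ereal_sup [set
        (\int[iid nu m \x iid gamma m]_w
           bochner_norm p (F \- Fhat (observations sigma F w.1 w.2))%R)%E
      | F in Fs]
    | Fhat in @estimator p _ (m.-tuple (borel X * borel Y)%type)]
  | nu in [set: probability (borel X) R]].

End minimax.

Definition neg_log_risk (R : realType) (M : nat -> \bar R) (m : nat) : \bar R :=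
  (- lne (M m))%E.

Definition lesssim (R : realType) (c : R) (A A' : nat -> \bar R) :=
  \forall m \near \oo, (A m <= c%:E * A' m)%E.

(* Main.v *)
Require Import Defs.
From HB Require Import structures.
From mathcomp Require Import all_boot all_order all_algebra finmap.
From mathcomp Require Import all_classical all_reals all_analysis.
From mathcomp Require Import measurable_realfun.
From mathcomp Require Import ring lra zify.

Set Implicit Arguments.
Unset Strict Implicit.
Unset Printing Implicit Defensive.

Import Order.TTheory GRing.Theory Num.Theory.
Import numFieldNormedType.Exports.

Local Open Scope classical_set_scope.
Local Open Scope ring_scope.

(** The exponent of the minimax risk is decided by geometry: m points have to
    resolve the Lipschitz functions of the leading coordinates of X, and
    averaging out the noise only changes constants in the exponent.

    Put l = log (m / sigma ^ 2), t = l ^ (1 / (omega + 1)) and s = t ^ omega, so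
    that l = t s and s is the claimed rate [log_scales]. On about t coordinates
    of the eigenbasis, m points form a grid of mesh m ^ (- 1 / t), which is
    exp (- s) up to the constant in the exponent, and the standard deviation of
    the coordinate of index t is exp (- tau s / 2). Taking N of order t
    coordinates balances the two effects, and every other quantity that appears
    below is of the form exp (- c t) or a constant, hence negligible against
    exp (- c s) because omega >= 1.

    Lower bound. Cut the cube [-a, a] ^ N of normalized coordinates into
    k ^ N >= 2 m cells and put on each cell a bump, Lipschitz and vanishing off
    the cell, with a sign [signed_bumps]. The data at m points only see the
    signs of at most m cells; flipping all the other signs gives a second
    function of the class with the same data, and the two differ by twice a bump
    on at least half of the cells. Averaging over all signs, no estimator does
    better than the L^p norm of half of the bumps, whatever the noise and
    whether the points are fixed or random [paired_average,
    bump_lower_bound]. Independence and the lower bound b on the densities make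
    the cores of the cells carry mass (a b) ^ N = (iota / 2) ^ N
    [cell_core_mass], and the power 1 / p of this costs exp (- c t).

    Upper bound. Take a grid of K points in N coordinates, draw the design
    uniformly on it, and predict, at x, the weighted mean of the responses
    observed at the grid point of the cell of x [grid_estimator]. A function of
    the class is bounded, so the L^p loss on the set of x that are too large or
    too far from their truncation is controlled by the probability of that set,
    which Markov's inequality bounds by second moments [off_grid_mass]. On the
    rest, the loss is the mesh of the grid plus the deviations of the weights
    and of the averaged noise, whose second moments are those of sums of
    independent draws [iid_second_moment, noise_energy]; K is a small power of
    m, so the bound K ^ 2 / sqrt m obtained by adding up the errors of all cells
    is still a power of m [grid_size_le]. Since the bound holds on average over
    the random design, it holds, up to a factor 2, for some fixed design
    [fixed_grid_risk]. *)

(** * Geometry of separable Hilbert spaces *)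

Section hilbert_geometry.
Context {R : realType} {V : hilbertType R}.
Implicit Types (x y z : V) (c : R).

Lemma innerDr x y z : inner x (y + z) = inner x y + inner x z.
Proof. by rewrite innerC innerDl !(innerC _ x). Qed.

Lemma innerZr c x y : inner x (c *: y) = c * inner x y.
Proof. by rewrite innerC innerZl innerC. Qed.

Lemma inner0l y : inner 0 y = 0 :> R.
Proof. by rewrite -(scale0r (0 : V)) innerZl mul0r. Qed.

Lemma inner0r x : inner x 0 = 0 :> R.
Proof. by rewrite innerC inner0l. Qed.

Lemma innerNl x y : inner (- x) y = - inner x y.
Proof. by rewrite -scaleN1r innerZl mulN1r. Qed.

Lemma innerNr x y : inner x (- y) = - inner x y.
Proof. by rewrite innerC innerNl innerC. Qed.

Lemma innerBl x y z : inner (x - y) z = inner x z - inner y z.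
Proof. by rewrite innerDl innerNl. Qed.

Lemma innerBr x y z : inner x (y - z) = inner x y - inner x z.
Proof. by rewrite innerDr innerNr. Qed.

Lemma inner_suml I (r : seq I) (P : pred I) (F : I -> V) y :
  inner (\sum_(i <- r | P i) F i) y = \sum_(i <- r | P i) inner (F i) y.
Proof.
by elim/big_rec2: _ => [|i a b _ <-]; [exact: inner0l|rewrite innerDl].
Qed.

Lemma inner_sumr I (r : seq I) (P : pred I) (F : I -> V) y :
  inner y (\sum_(i <- r | P i) F i) = \sum_(i <- r | P i) inner y (F i).
Proof. by rewrite innerC inner_suml; under eq_bigr do rewrite innerC. Qed.

Lemma cauchy_schwarz x y : `|inner x y| <= `|x| * `|y|.
Proof.
have [y0|y0] := eqVneq `|y| 0.
  by rewrite (normr0_eq0 y0) inner0r !normr0 mulr0.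
have ygt0 : 0 < `|y| by rewrite lt_def y0 normr_ge0.
have y2 : `|y| ^+ 2 != 0 by rewrite expf_neq0.
have : 0 <= `|x - (inner x y / `|y| ^+ 2) *: y| ^+ 2 by rewrite exprn_ge0.
rewrite -inner_norm innerBl !innerBr !innerZl !innerZr !inner_norm.
rewrite (innerC y x) divfK// subrr subr0 mulrAC -expr2 subr_ge0 => xy.
rewrite -ler_sqr ?nnegrE ?mulr_ge0// real_normK ?num_real// exprMn.
by rewrite -ler_pdivrMr ?exprn_gt0.
Qed.

(** The zero vectors allow an orthonormal family indexed by a countable type
    to be padded into a sequence. *)
Definition padded_orthonormal (e : nat -> V) :=
  exists b : nat -> bool, forall i j, inner (e i) (e j) = ((i == j) && b i)%:R.

Definition spanning (e : nat -> V) := closure (linear_span (range e)) = [set: V].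

Definition span_proj (e : nat -> V) n x := \sum_(i < n) inner x (e i) *: e i.

Lemma inner_span_proj e n x k : padded_orthonormal e ->
  inner (span_proj e n x) (e k) = (k < n)%:R * inner x (e k).
Proof.
move=> [b eb]; rewrite inner_suml.
have [kn|nk] := ltnP k n; last first.
  rewrite mul0r big1 // => i _; rewrite innerZl eb.
  by rewrite ltn_eqF ?mulr0// (leq_trans (ltn_ord i)).
rewrite (bigD1 (Ordinal kn))//= big1 => [|i ik]; last first.
  by rewrite innerZl eb -val_eqE/= in ik *; rewrite (negbTE ik) mulr0.
rewrite innerZl eb eqxx /= addr0 mul1r.
case bk : (b k); first by rewrite mulr1.
suff -> : e k = 0 by rewrite inner0r mul0r.
apply/normr0_eq0/eqP; rewrite -sqrf_eq0; apply/eqP.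
by rewrite -inner_norm eb eqxx bk.
Qed.

Lemma inner_residual e n x k : padded_orthonormal e ->
  inner (x - span_proj e n x) (e k) = (n <= k)%:R * inner x (e k).
Proof.
move=> eo; rewrite innerBl inner_span_proj//.
by case: ltnP => _; rewrite ?(mul1r, mul0r) ?subrr ?subr0.
Qed.

Lemma residual_orthogonal e n x : padded_orthonormal e ->
  inner (x - span_proj e n x) (span_proj e n x) = 0.
Proof.
move=> eo; rewrite inner_sumr big1// => i _.
by rewrite innerZr inner_residual// leqNgt ltn_ord mul0r mulr0.
Qed.

Lemma residual_norm e n x : padded_orthonormal e ->
  `|x - span_proj e n x| ^+ 2 = `|x| ^+ 2 - \sum_(i < n) inner x (e i) ^+ 2.
Proof.
move=> eo; rewrite -inner_norm [LHS]innerBr residual_orthogonal// subr0.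
rewrite innerBl inner_norm inner_suml; congr (_ - _).
by apply: eq_bigr => i _; rewrite innerZl (innerC (e i)) expr2.
Qed.

(** A vector of the span is a combination of finitely many members of the
    family, so orthogonality to it is decided by finitely many coordinates. *)
Lemma linear_span_tail e v : linear_span (range e) v -> exists n, forall z,
  (forall i, (i < n)%N -> inner z (e i) = 0) -> inner z v = 0.
Proof.
move=> [m [f [c [fe ->]]]].
have /choice[k fk] : forall i, exists k, e k = f i.
  by move=> i; have [k _ <-] := fe i; exists k.
exists (\max_(i < m) k i).+1 => z ze; rewrite inner_sumr big1// => i _.
by rewrite innerZr -fk ze ?mulr0// ltnS; exact: leq_bigmax.
Qed.

(** If v in the span is close to x, the residual r of a long enough projection
    is orthogonal both to v and to the projection, whence |r| ^ 2 = <r, x - v>. *)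
Lemma span_proj_approx e x eps : padded_orthonormal e -> spanning e -> 0 < eps ->
  exists n, `|x - span_proj e n x| < eps.
Proof.
move=> eo es eps0.
have : closure (linear_span (range e)) x by rewrite es.
move=> /(_ _ (nbhsx_ballx x eps eps0))[v [ev]].
rewrite -ball_normE/= => xv; have [n en] := linear_span_tail ev; exists n.
apply: le_lt_trans xv; set r := x - span_proj e n x.
have rv : inner r v = 0.
  by apply: en => i i_n; rewrite inner_residual// leqNgt i_n mul0r.
have : `|r| ^+ 2 <= `|r| * `|x - v|.
  rewrite -inner_norm {2}/r innerBr residual_orthogonal//.
  rewrite subr0 -[X in X <= _]subr0 -rv -innerBr.
  exact: le_trans (ler_norm _) (cauchy_schwarz _ _).
have [->|r0] := eqVneq `|r| 0; first by rewrite normr_ge0.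
by rewrite expr2 ler_pM2l// lt_def r0 normr_ge0.
Qed.

Lemma parseval_le e x : padded_orthonormal e -> spanning e ->
  ((`|x| ^+ 2)%:E <= \sum_(i <oo) (inner x (e i) ^+ 2)%:E)%E.
Proof.
move=> eo es; apply/lee_addgt0Pr => eps eps0.
have [|n rn] := @span_proj_approx e x (Num.sqrt eps) eo es; first by rewrite sqrtr_gt0.
have {rn} : `|x - span_proj e n x| ^+ 2 <= eps.
  rewrite -[leRHS](sqr_sqrtr (ltW eps0)).
  by rewrite ler_pXn2r ?nnegrE ?sqrtr_ge0// ltW.
rewrite residual_norm// lerBlDl => xn.
apply: (@le_trans _ _ (\sum_(i < n) (inner x (e i) ^+ 2)%:E + eps%:E)%E).
  by rewrite sumEFin lee_fin.
rewrite leeD2r// -(big_mkord xpredT (fun i => (inner x (e i) ^+ 2)%:E)).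
by apply: nneseries_lim_ge => i _ _; rewrite lee_fin sqr_ge0.
Qed.

Lemma residual_le e n x : padded_orthonormal e -> spanning e ->
  ((`|x - span_proj e n x| ^+ 2)%:E <=
   \sum_(i <oo) ((n <= i)%:R * inner x (e i) ^+ 2)%:E)%E.
Proof.
move=> eo es; apply: le_trans (parseval_le _ eo es) _.
apply: lee_nneseries => [i _ _|i _]; first by rewrite lee_fin sqr_ge0.
by rewrite inner_residual// exprMn -natrX; case: (n <= i)%N.
Qed.

Lemma dense_near (D : set V) x eps : dense D -> 0 < eps ->
  exists2 y, D y & `|x - y| < eps.
Proof.
move=> Dd eps0; have [||y [xy Dy]] := Dd (ball x eps).
- by exists x; exact: ballxx.
- exact: ball_open.
by exists y => //; rewrite -ball_normE in xy.
Qed.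

(** Two distinct vectors of an orthonormal family are at distance sqrt 2, so
    in a separable space such a family is countable. *)
Lemma orthonormal_countable (I : choiceType) (e : I -> V) :
  separable V -> (forall i j, inner (e i) (e j) = (i == j)%:R) ->
  exists f : I -> nat, injective f.
Proof.
move=> [D [/countable_injP[g gi] Dd]] eo.
have /choice[d de] : forall i, exists d, D d /\ `|e i - d| < 2^-1.
  by move=> i; have [|d Dd' ed] := @dense_near D (e i) 2^-1 Dd; [|exists d].
exists (g \o d) => i j /= gij.
have dij : d i = d j by apply: gi => //; rewrite inE; [case: (de i)|case: (de j)].
apply/eqP/negPn/negP => ij.
have : `|e i - e j| < 1.
  rewrite -(subrKA (d i)) (le_lt_trans (ler_normD _ _))//.
  have [_ h1] := de i; have [_ h2] := de j.
  by rewrite [ltRHS](splitr 1) ltrD ?div1r// dij distrC.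
rewrite -(@ltr_pXn2r _ 2)// ?nnegrE// expr1n -inner_norm.
rewrite innerBl !innerBr !eo !eqxx (negbTE ij) eq_sym (negbTE ij).
by rewrite subr0 sub0r opprK ltNge lerDl ler01.
Qed.

(** Sums over an orthonormal basis become series, to which monotone convergence
    applies. *)
Lemma orthonormal_basis_seq (I : choiceType) (e : I -> V) :
  separable V -> orthonormal_basis e ->
  exists e' : nat -> V, [/\ padded_orthonormal e', spanning e' &
    forall f : V -> \bar R, f 0 = 0%E -> (forall x, 0 <= f x)%E ->
      (\sum_(n <oo) f (e' n) = \esum_(i in [set: I]) f (e i))%E].
Proof.
move=> sV [eo es]; have [g gi] := orthonormal_countable sV eo.
pose dec n := pselect (exists i, g i = n).
pose e' n := if dec n is left h then e (projT1 (cid h)) else 0.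
have e'g i : e' (g i) = e i.
  rewrite /e'; case: (dec _) => [h|]; last by case; exists i.
  by congr e; apply: gi; case: cid.
have e'0 n : ~ (exists i, g i = n) -> e' n = 0 by rewrite /e'; case: (dec _).
exists e'; split.
- exists (fun n => `[< exists i, g i = n >]) => m n.
  case: (asboolP (exists i, g i = m)) => [[i <-]|/e'0->]; last first.
    by rewrite inner0l andbF.
  case: (pselect (exists i, g i = n)) => [[j <-]|nn]; last first.
    rewrite (e'0 _ nn) inner0r andbT; case: eqP => // ij.
    by case: nn; exists i.
  by rewrite !e'g eo andbT (inj_eq gi).
- rewrite /spanning -subTset -[X in X `<=` _]es; apply: closureS.
  move=> v [n [u [c [ue ->]]]]; exists n, u, c; split => // i.
  by have [j _ <-] := ue i; exists (g j).
- move=> f f0 f_ge0; rewrite nneseries_esumT//.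
  transitivity (\esum_(n in range g) f (e' n))%E; last first.
    rewrite (@esum_image R _ _ [set: I] g); last by move=> i j _ _; exact: gi.
    by apply: eq_esum => i _; rewrite e'g.
  rewrite [RHS]esum_mkcond; apply: eq_esum => n _.
  case: ifPn => // /negP; rewrite inE => nn; rewrite e'0// => -[i ni].
  by apply: nn; exists i.
Qed.

End hilbert_geometry.

(** * Measurability of Hilbert-valued functions *)

(** The integral of a nonnegative function is a supremum over simple functions,
    so it is monotone on all nonnegative functions, measurable or not. *)
Lemma ge0_le_integral_nonmeasurable d (T : measurableType d) (R : realType)
    (mu : {measure set T -> \bar R}) (f g : T -> \bar R) :
  (forall x, 0 <= f x)%E -> (forall x, f x <= g x)%E ->
  (\int[mu]_x f x <= \int[mu]_x g x)%E.
Proof.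
move=> f0 fg; rewrite !ge0_integralTE//; last first.
  by move=> x; exact: le_trans (f0 x) (fg x).
by apply: ereal_sup_le => _ [h hf <-]; exists h => // x; exact: le_trans (hf x) (fg x).
Qed.

Section borel_measurability.
Context {R : realType} {V : hilbertType R}.

Lemma borel_open (U : set V) : open U -> measurable (U : set (borel V)).
Proof. by move=> oU; exact: sub_sigma_algebra. Qed.

Lemma borel_closed (U : set V) : closed U -> measurable (U : set (borel V)).
Proof.
move=> cU; rewrite -(setCK U); apply: measurableC; apply: borel_open.
exact: closed_openC.
Qed.

Lemma borel_set1 (v : V) : measurable ([set v] : set (borel V)).
Proof.
apply: borel_closed; apply: (accessible_finite_set_closed.1 _ _ (finite_set1 v)).
exact/hausdorff_accessible/norm_hausdorff.
Qed.

Lemma lipschitz_continuous (W : hilbertType R) (f : V -> W) (k : R) :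
  (forall x y, `|f x - f y| <= k * `|x - y|) -> continuous f.
Proof.
move=> fk x; have k1 : 0 < `|k| + 1 by rewrite ltr_wpDl.
apply/cvgrPdist_lt => e e0; near=> y.
apply: le_lt_trans (fk _ _) _.
apply: (@le_lt_trans _ _ ((`|k| + 1) * `|x - y|)).
  by rewrite ler_wpM2r// (le_trans (ler_norm k))// lerDl.
rewrite -ltr_pdivlMl// mulrC; near: y.
by apply: cvgr_dist_lt => //; rewrite divr_gt0.
Unshelve. all: by end_near. Qed.

Lemma continuous_borel (W : hilbertType R) (f : V -> W) : continuous f ->
  measurable_fun [set: borel V] (f : borel V -> borel W).
Proof.
move=> /continuousP cf; apply: (measurability (rT := borel W) (@open W)) => //.
by move=> _ [U oU <-]; rewrite setTI; apply: borel_open; exact: cf.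
Qed.

Lemma continuous_borel_real (f : V -> R) : continuous f ->
  measurable_fun [set: borel V] (f : borel V -> R).
Proof.
move=> /continuousP cf; apply: (measurability _ (RGenOpens.measurableE R)).
move=> _ [_ [a [b ->] <-]]; rewrite setTI; apply: borel_open.
exact/cf/interval_open.
Qed.

Lemma inner_continuous (y : V) : continuous (fun x : V => inner x y).
Proof.
move=> x; have k1 : 0 < `|y| + 1 by rewrite ltr_wpDl.
apply/cvgrPdist_lt => e e0; near=> z.
rewrite -innerBl (le_lt_trans (cauchy_schwarz _ _))//.
apply: (@le_lt_trans _ _ (`|x - z| * (`|y| + 1))).
  by rewrite ler_wpM2l// lerDl.
rewrite -ltr_pdivlMr//; near: z.
by apply: cvgr_dist_lt => //; rewrite divr_gt0.
Unshelve. all: by end_near. Qed.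

Lemma measurable_inner (y : V) :
  measurable_fun [set: borel V] (fun x : borel V => inner (x : V) y).
Proof. by apply: continuous_borel_real; exact: inner_continuous. Qed.

Lemma measurable_borel_norm :
  measurable_fun [set: borel V] (fun x : borel V => `|x : V|).
Proof. by apply: continuous_borel_real; exact: norm_continuous. Qed.

End borel_measurability.

Section separable_measurability.
Context {R : realType} {V : hilbertType R} (sV : separable V).
Context d {T : measurableType d}.

(** Separability makes an open subset of a finite power of V a countable union
    of products of balls, that is, the Borel sets of the power are in the
    product sigma-algebra. *)
Lemma measurable_open_preimage (I : finType) (f : I -> T -> borel V)
    (W : set (I -> V)) :
  (forall i, measurable_fun setT (f i)) ->
  (forall v, W v -> exists2 r : R, 0 < r &
     forall v', (forall i, `|v i - v' i| < r) -> W v') ->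
  measurable [set t | W (fun i => f i t)].
Proof.
move=> mf Wo; have [D [/countable_injP[g gi] Dd]] := sV.
pose u n := if pselect (exists2 x, D x & g x = n) is left h
            then projT1 (cid2 h) else 0.
have ug x : D x -> u (g x) = x.
  move=> Dx; rewrite /u; case: (pselect _) => [h|]; last by case; exists x.
  by case: cid2 => //= y Dy gyx; apply: gi => //; rewrite inE.
pose box (a : {ffun I -> nat} * nat) : set (I -> V) :=
  [set v | forall i, `|u (a.1 i) - v i| < a.2.+1%:R^-1].
rewrite (_ : [set t | _] = \bigcup_(a in [set: {ffun I -> nat} * nat])
  [set t | box a `<=` W /\ box a (fun i => f i t)]); last first.
  apply/seteqP; split=> [t /= Wt|t [a _ [aW /aW]]//].
  have [r r0 rW] := Wo _ Wt.
  have [n nr] : exists n, n.+1%:R^-1 + n.+1%:R^-1 <= r.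
    exists (Num.truncn (2 / r)).
    rewrite -mulr2n -[leLHS]mulr_natl ler_pdivrMr ?ltr0Sn// mulrC.
    by rewrite -ler_pdivrMr// ltW// truncnS_gt.
  have n0 : 0 < n.+1%:R^-1 :> R by rewrite invr_gt0.
  have /choice[s sD] : forall i, exists k, `|u k - f i t| < n.+1%:R^-1.
    move=> i; have [y Dy fy] := @dense_near _ _ D (f i t) _ Dd n0.
    by exists (g y); rewrite ug// distrC.
  exists ([ffun i => s i], n) => //; split => [v|i]/=; last by rewrite ffunE.
  move=> vn; apply: rW => i; apply: lt_le_trans nr.
  rewrite -(subrKA (u (s i))) (le_lt_trans (ler_normD _ _))// ltrD//.
    by rewrite distrC.
  by have /= := vn i; rewrite ffunE.
apply: countable_bigcupT_measurable => [|[a n]]; first exact: countableP.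
have [aW|aW] := pselect (box (a, n) `<=` W); last first.
  by rewrite (_ : [set t | _] = set0)//; apply/seteqP; split => // t [].
rewrite (_ : [set t | _] = \bigcap_(i in [set: I])
    (f i @^-1` (fun x => `|u (a i) - x| < n.+1%:R^-1))).
  apply: fin_bigcap_measurable; first exact: finite_finset.
  move=> i _; rewrite -[X in measurable X]setTI; apply: mf => //.
  rewrite (_ : (fun x => _) = ball (u (a i)) n.+1%:R^-1); last first.
    by rewrite -ball_normE.
  by apply: borel_open; exact: ball_open.
by apply/seteqP; split=> [t [_ ta] i _|t ta]; [exact: ta|split => // i; exact: ta].
Qed.

Lemma measurable_sumV (I : finType) (f : I -> T -> borel V) :
  (forall i, measurable_fun setT (f i)) ->
  measurable_fun setT (fun t => (\sum_i (f i t : V)) : borel V).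
Proof.
move=> mf; apply: (measurability (rT := borel V) (@open V)) => //.
move=> _ [U oU <-]; rewrite setTI.
apply: (@measurable_open_preimage I f (fun v => U (\sum_i v i))) => // v Uv.
have := open_nbhs_nbhs (conj oU Uv); rewrite -nbhs_ballE => -[r /= r0 rU].
have k0 : 0 < #|I|.+1%:R :> R by rewrite ltr0Sn.
exists (r / #|I|.+1%:R); first by rewrite divr_gt0.
move=> v' vv'; apply: rU; rewrite -ball_normE/= -sumrB.
apply: le_lt_trans (ler_norm_sum _ _ _) _.
apply: (@le_lt_trans _ _ (\sum_(i : I) r / #|I|.+1%:R)).
  by apply: ler_sum => i _; exact/ltW.
rewrite sumr_const -[ltLHS]mulr_natr mulrAC ltr_pdivrMr// ltr_pM2l//.
by rewrite ltr_nat cardT.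
Qed.

Lemma measurable_addV (f g : T -> borel V) :
  measurable_fun setT f -> measurable_fun setT g ->
  measurable_fun setT (fun t => ((f t : V) + (g t : V)) : borel V).
Proof.
move=> mf mg; rewrite (_ : (fun t => _) =
    (fun t => (\sum_(b : bool) ((if b then f t else g t) : V)))); last first.
  by apply/funext => t; rewrite big_bool.
by apply: (@measurable_sumV _ (fun b t => if b then f t else g t)) => -[].
Qed.

Lemma measurable_scaleV (c : R) (f : T -> borel V) :
  measurable_fun setT f ->
  measurable_fun setT (fun t => (c *: (f t : V)) : borel V).
Proof.
move=> mf; apply: (measurableT_comp _ mf); apply: continuous_borel.
by move=> x; exact: scaler_continuous.
Qed.

Lemma measurable_subV (f g : T -> borel V) :
  measurable_fun setT f -> measurable_fun setT g ->
  measurable_fun setT (fun t => ((f t : V) - (g t : V)) : borel V).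
Proof.
move=> mf mg; apply: measurable_addV => //.
under eq_fun do rewrite -scaleN1r; exact: measurable_scaleV.
Qed.

Lemma measurable_normV (f : T -> borel V) :
  measurable_fun setT f -> measurable_fun setT (fun t => `|f t : V|).
Proof. by move=> mf; apply: (measurableT_comp _ mf); exact: measurable_borel_norm. Qed.

End separable_measurability.

(** * The Bochner norm and the risk of an estimator *)

Section Lnorm.
Context d (T : measurableType d) (R : realType).
Variables (mu : probability T R) (p : R).
Hypothesis (p1 : 1 <= p).
Local Open Scope ereal_scope.

Let p0 : (0 < p)%R. Proof. exact: lt_le_trans p1. Qed.

Lemma le_Lnorm (f g : T -> R) : (forall x, `|f x| <= `|g x|)%R ->
  'N[mu]_p%:E[EFin \o f] <= 'N[mu]_p%:E[EFin \o g].
Proof.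
move=> fg; rewrite unlock /Lnorm; apply: gt0_ler_poweR.
- by rewrite invr_ge0 ltW.
- by rewrite in_itv/= leey andbT integral_ge0// => x _; exact: poweR_ge0.
- by rewrite in_itv/= leey andbT integral_ge0// => x _; exact: poweR_ge0.
apply: ge0_le_integral_nonmeasurable => x; first exact: poweR_ge0.
by rewrite /= lee_fin ge0_ler_powR ?nnegrE// ltW.
Qed.

Lemma Lnorm_cst (k : R) : (0 <= k)%R -> 'N[mu]_p%:E[EFin \o cst k] = k%:E.
Proof.
move=> k0; rewrite unlock /Lnorm /=.
rewrite integral_cst//= probability_setT mule1 poweR_EFin -powRrM mulfV ?gt_eqF//.
by rewrite ger0_norm// powRr1.
Qed.

Lemma Lnorm_indic (k : R) (A : set T) : (0 <= k)%R -> measurable A ->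
  'N[mu]_p%:E[EFin \o (fun x => k * \1_A x)%R] = k%:E * mu A `^ p^-1.
Proof.
move=> k0 mA; rewrite unlock /Lnorm /=.
rewrite (eq_integral (fun x => (k `^ p)%:E * (\1_A x)%:E)); last first.
  move=> x _; rewrite ger0_norm ?mulr_ge0// powRM// EFinM.
  by rewrite indicE; case: (x \in A); rewrite ?powR1// powR0// gt_eqF.
rewrite ge0_integralZl_EFin ?powR_ge0//; last first.
  exact/measurable_EFinP/measurable_indic.
rewrite integral_indic// setIT poweRM// ?lee_fin ?powR_ge0// poweR_EFin.
by rewrite -powRrM mulfV ?gt_eqF// powRr1.
Qed.

End Lnorm.

Section bochner_norm.
Context {R : realType} {X Y : hilbertType R}.
Variables (mu : probability (borel X) R) (p : R).
Hypothesis (p1 : 1 <= p).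
Implicit Types (F G H : X -> Y).
Local Open Scope ereal_scope.

Lemma bochner_norm_ge0 F : 0 <= bochner_norm mu p F.
Proof. exact: Lnorm_ge0. Qed.

Lemma bochner_norm_bounded F (B : R) : (forall x, `|F x| <= B)%R ->
  bochner_norm mu p F <= B%:E.
Proof.
move=> FB; have B0 : (0 <= B)%R := le_trans (normr_ge0 _) (FB 0%R).
rewrite -[leRHS](Lnorm_cst mu p1 B0); apply: le_Lnorm => // x /=.
by rewrite normr_id ger0_norm.
Qed.

Hypothesis sY : separable Y.

Let mfun F := measurable_fun [set: borel X] (F : borel X -> borel Y).

Lemma measurable_normB F G : mfun F -> mfun G ->
  measurable_fun [set: borel X] (fun x => `|(F \- G)%R x|%R).
Proof. by move=> mF mG; apply: measurable_normV; exact: measurable_subV. Qed.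

Lemma bochner_triangle F G H : mfun F -> mfun G -> mfun H ->
  bochner_norm mu p (F \- H)%R <=
  bochner_norm mu p (F \- G)%R + bochner_norm mu p (H \- G)%R.
Proof.
move=> mF mG mH; apply: le_trans (minkowski_EFin mu _ _ p1).
- apply: le_Lnorm => // x /=; rewrite normr_id ger0_norm ?addr_ge0//.
  by rewrite -(subrKA (G x)) (le_trans (ler_normD _ _))// lerD2l distrC.
- exact: measurable_normB.
- exact: measurable_normB.
Qed.

Lemma bochner_open_ball F (r : R) : mfun F ->
  bochner_open mu p [set G | bochner_norm mu p (F \- G)%R < r%:E].
Proof.
move=> mF G [mG _] /= Gr.
have Gfin : bochner_norm mu p (F \- G)%R \is a fin_num.
  by rewrite ge0_fin_numE ?bochner_norm_ge0// (lt_trans Gr)// ltry.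
exists (r - fine (bochner_norm mu p (F \- G)%R))%R => [|H [mH _] GH].
  by rewrite subr_gt0 -lte_fin fineK.
apply: le_lt_trans (bochner_triangle mF mG mH) _.
by rewrite addeC -lteBrDr// -[X in _ - X]fineK.
Qed.

(** The sublevel sets of the loss are preimages of balls of L^p centred at F. *)
Lemma risk_measurable d (D : measurableType d) d' (T : measurableType d')
    (Fhat : D -> X -> Y) (obs : T -> D) F :
  estimator mu p Fhat -> measurable_fun setT obs -> mfun F ->
  measurable_fun setT (fun t => bochner_norm mu p (F \- Fhat (obs t))%R).
Proof.
move=> [_ eF] mobs mF.
apply: (measurability _ (ErealGenInftyO.measurableE R)).
move=> _ [_ [r ->] <-]; rewrite setTI.
have := mobs measurableT _ (eF _ (@bochner_open_ball F r mF)).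
by rewrite setTI; congr measurable; apply/seteqP; split => t /=; rewrite in_itv.
Qed.

End bochner_norm.

(** Averaging over a finite family of hypotheses: if each hypothesis i has, for
    every outcome, a partner s i that together with i costs 2 rho, then one of
    them has an expected cost of rho. *)
Lemma paired_average d (T : measurableType d) (R : realType)
    (P : probability T R) (I : finType) (g : I -> T -> \bar R) (rho : R)
    (S : \bar R) :
  (0 < #|I|)%N -> (forall i, measurable_fun setT (g i)) ->
  (forall i t, 0 <= g i t)%E ->
  (forall t, exists2 s : I -> I, involutive s &
     forall i, ((2 * rho)%:E <= g i t + g (s i) t)%E) ->
  (forall i, \int[P]_t g i t <= S)%E -> (rho%:E <= S)%E.
Proof.
move=> I0 mg g0 gs gS.
have I0' : 0 < #|I|%:R :> R by rewrite ltr0n.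
have lb t : ((#|I|%:R * rho)%:E <= \sum_i g i t)%E.
  have [s si gsi] := gs t.
  have : ((#|I|%:R * (2 * rho))%:E <= \sum_i g i t + \sum_i g i t)%E.
    rewrite [X in (_ <= _ + X)%E](reindex_inj (inv_inj si))/= -big_split/=.
    apply: le_trans (lee_sum _ (fun i _ => gsi i)).
    by rewrite sumEFin sumr_const mulr_natl.
  have : (0 <= \sum_i g i t)%E by apply: sume_ge0 => i _; exact: g0.
  case: (\sum_i g i t)%E => [r| |]//= _; last by move=> _; rewrite leey.
  by rewrite -EFinD !lee_fin mulrCA -mulr2n -(mulr_natl r) ler_pM2l.
have [i0 _] : exists i0 : I, true by move/card_gt0P : I0 => [i _]; exists i.
have S0 : (0 <= S)%E by apply: le_trans (gS i0); exact: integral_ge0.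
have : ((#|I|%:R * rho)%:E <= \sum_(i : I) S)%E.
  apply: le_trans (lee_sum _ (fun i _ => gS i)).
  rewrite -ge0_integral_sum//.
  rewrite -[leLHS]mule1 -(@probability_setT _ _ _ P) -integral_cst//.
  have [r0|r0] := leP 0 rho.
    apply: ge0_le_integral_nonmeasurable => t /=; last exact: lb.
    by rewrite lee_fin mulr_ge0.
  rewrite integral_cst//= probability_setT mule1.
  apply: (@le_trans _ _ 0%E); last first.
    by apply: integral_ge0 => t _; apply: sume_ge0 => i _; exact: g0.
  by rewrite lee_fin pmulr_rle0// ltW.
move: S S0 {gS} => [S| |]//= S0; last by rewrite leey.
by rewrite sumEFin sumr_const -[S *+ _]mulr_natl lee_fin ler_pM2l.
Qed.

(** * Lower bound: signed bumps *)

Section signed_bumps.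
Context {R : realType} {X Y : hilbertType R} {J : finType}.
Variables (bump : J -> X -> R) (y0 : Y).
Implicit Types (theta : {ffun J -> bool}) (U : {set J}).

Definition signed_bumps theta (x : X) : Y :=
  (\sum_j (-1) ^+ theta j * bump j x) *: y0.

Definition flip U theta : {ffun J -> bool} :=
  [ffun j => if j \in U then ~~ theta j else theta j].

Lemma flip_involutive U : involutive (flip U).
Proof.
move=> theta; apply/ffunP => j; rewrite !ffunE.
by case: (j \in U); rewrite ?negbK.
Qed.

(** Flipping signs of bumps that vanish at a point is invisible there. *)
Lemma signed_bumps_flip U theta x :
  (forall j, j \in U -> bump j x = 0) ->
  signed_bumps (flip U theta) x = signed_bumps theta x.
Proof.
move=> Ux; congr (_ *: _); apply: eq_bigr => j _; rewrite ffunE.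
by case: ifPn => // /Ux ->; rewrite !mulr0.
Qed.

Hypothesis y0_unit : `|y0| = 1.
Variables (B L : R).
Hypothesis bump_bounds : forall j x, 0 <= bump j x <= B.
Hypothesis bump_disjoint : forall j l x,
  bump j x != 0 -> bump l x != 0 -> j = l.
Hypothesis bump_lipschitz : forall j x x',
  `|bump j x - bump j x'| <= L / 2 * `|x - x'|.

Lemma signed_bumps_at theta x j : bump j x != 0 ->
  signed_bumps theta x = ((-1) ^+ theta j * bump j x) *: y0.
Proof.
move=> xj; rewrite /signed_bumps (bigD1 j)//= big1 ?addr0// => l lj.
have [->|xl] := eqVneq (bump l x) 0; first by rewrite mulr0.
by rewrite (bump_disjoint xl xj) eqxx in lj.
Qed.

(** At most two bumps differ between two points, the one alive at each of them. *)
Lemma signed_bumps_lip theta : 0 <= B -> 0 <= L -> lip_class B L (signed_bumps theta).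
Proof.
move=> B0 L0; split => [x|x x'].
  have [xj|x0] := pselect (exists j, bump j x != 0).
    have [j xj'] := xj; rewrite (signed_bumps_at _ xj') normrZ y0_unit mulr1.
    rewrite normrM normrX normrN1 expr1n mul1r.
    by have /andP[b0 bB] := bump_bounds j x; rewrite ger0_norm.
  rewrite /signed_bumps big1 ?scale0r ?normr0// => j _.
  have [->|xj] := eqVneq (bump j x) 0; first by rewrite mulr0.
  by case: x0; exists j.
rewrite -scalerBl normrZ y0_unit mulr1 -sumrB.
apply: le_trans (ler_norm_sum _ _ _) _.
under eq_bigr do rewrite -mulrBr normrM normrX normrN1 expr1n mul1r.
pose A x : {set J} := [set j | bump j x != 0]%SET.
have A1 z : (#|A z| <= 1)%N.
  by apply/card_le1_eqP => j l; rewrite !inE => jz lz; exact: (bump_disjoint lz jz).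
rewrite (bigID (mem (A x :|: A x')))/= [X in _ + X]big1 ?addr0; last first.
  move=> j; rewrite !inE negb_or !negbK => /andP[/eqP -> /eqP ->].
  by rewrite subrr normr0.
apply: le_trans (ler_sum _ (fun j _ => bump_lipschitz j x x')) _.
rewrite sumr_const -[leLHS]mulr_natl.
apply: (@le_trans _ _ (2 * (L / 2 * `|x - x'|))).
  rewrite ler_wpM2r//; first by rewrite mulr_ge0// divr_ge0.
  rewrite ler_nat (leq_trans (leq_card_setU _ _).1)//.
  by rewrite -[2%N]/(1 + 1)%N leq_add.
by rewrite mulrA mulrCA divff ?mulr1// pnatr_eq0.
Qed.

End signed_bumps.

Section bump_lower_bound.
Context {R : realType} {X Y : hilbertType R}.
Variables (mu : probability (borel X) R) (p : R).
Hypotheses (p1 : 1 <= p) (sY : separable Y).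
Variables (J : finType) (bump : J -> X -> R) (y0 : Y) (B L : R).
Hypotheses (y0_unit : `|y0| = 1) (B0 : 0 <= B) (L0 : 0 <= L).
Hypothesis bump_bounds : forall j x, 0 <= bump j x <= B.
Hypothesis bump_disjoint : forall j l x,
  bump j x != 0 -> bump l x != 0 -> j = l.
Hypothesis bump_lipschitz : forall j x x',
  `|bump j x - bump j x'| <= L / 2 * `|x - x'|.
Variables (core : J -> set (borel X)) (h kappa : R).
Hypotheses (h0 : 0 < h) (kappa0 : 0 <= kappa).
Hypothesis measurable_core : forall j, measurable (core j).
Hypothesis core_bump : forall j x, core j x -> h <= bump j x.
Hypothesis core_mass : forall j, ((kappa / #|J|%:R)%:E <= mu (core j))%E.
Local Notation signed := (signed_bumps bump y0).

Lemma core_bump_neq0 j x : core j x -> bump j x != 0.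
Proof. by move=> /core_bump /(lt_le_trans h0) /gt_eqF ->. Qed.

(** On the cores of the flipped cells, which carry at least half of the mass
    kappa, the two functions differ by twice a bump. *)
Lemma flip_distance (U : {set J}) theta : (#|J| <= 2 * #|U|)%N -> (0 < #|J|)%N ->
  ((2 * (h * (kappa / 2) `^ p^-1))%:E <=
   bochner_norm mu p (signed theta \- signed (flip U theta))%R)%E.
Proof.
move=> JU J0; pose A : set (borel X) := \bigcup_(j in [set` enum U]) core j.
have mA : measurable A by apply: fin_bigcup_measurable => // j _.
have muA : ((kappa / 2)%:E <= mu A)%E.
  rewrite measure_fin_bigcup//; last first.
    move=> j l _ _ [x [jx lx]].
    exact: (bump_disjoint (core_bump_neq0 jx) (core_bump_neq0 lx)).
  rewrite -fsbig_seq ?enum_uniq// big_enum/=.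
  apply: le_trans (lee_sum _ (fun j _ => core_mass j)).
  rewrite sumEFin sumr_const lee_fin -[leRHS]mulr_natr.
  rewrite -mulrA ler_wpM2l// ler_pdivlMl ?ltr0n// ler_pdivrMr//.
  by rewrite -natrM ler_nat mulnC.
apply: (@le_trans _ _ 'N[mu]_p%:E[EFin \o (fun x => 2 * h * \1_A x)%R]%E).
  rewrite Lnorm_indic ?mulr_ge0 ?(ltW h0)//.
  rewrite mulrA EFinM lee_pmul2l ?lte_fin ?mulr_gt0//.
  rewrite -poweR_EFin gt0_ler_poweR ?invr_ge0 ?(le_trans _ p1)//.
  - by rewrite in_itv/= leey lee_fin divr_ge0.
  - by rewrite in_itv/= leey measure_ge0.
apply: le_Lnorm => // x; rewrite /= normr_id indicE.
have [|_] := boolP (x \in A); last by rewrite mulr0 normr0.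
rewrite inE => -[j /=]; rewrite mem_enum => jU jx.
have bj := core_bump_neq0 jx; rewrite /= !(signed_bumps_at y0 bump_disjoint _ bj) ffunE jU.
rewrite -scalerBl [leRHS]normrZ y0_unit !mulr1 -mulrBl [leRHS]normrM.
rewrite [leLHS]ger0_norm ?mulr_ge0 ?(ltW h0)// ler_pM ?(ltW h0)//.
  by case: (theta j); rewrite /= expr0 expr1 ?opprK -?opprD ?normrN ger0_norm.
exact: le_trans (core_bump jx) (ler_norm _).
Qed.

(** At most m bumps are alive at some of the m points, so at least half of the
    signs can be flipped without changing the data. *)
Lemma bump_lower_bound (m : nat) d (T : measurableType d)
    (P : probability T R) d' (D : measurableType d') (obs : (X -> Y) -> T -> D)
    (pts : T -> 'I_m -> X) (Fhat : D -> X -> Y) (S : \bar R) :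
  (0 < #|J|)%N -> (2 * m <= #|J|)%N ->
  (forall F, lip_class B L F -> measurable_fun setT (obs F)) ->
  (forall F G t, (forall i, F (pts t i) = G (pts t i)) -> obs F t = obs G t) ->
  estimator mu p Fhat ->
  (forall F, lip_class B L F ->
    (\int[P]_t bochner_norm mu p (F \- Fhat (obs F t))%R <= S)%E) ->
  ((h * (kappa / 2) `^ p^-1)%:E <= S)%E.
Proof.
move=> J0 mJ mobs obs_local eF FS.
have signedP theta : lip_class B L (signed theta) by exact: signed_bumps_lip.
have msigned theta : measurable_fun [set: borel X] (signed theta : borel X -> borel Y).
  by apply: continuous_borel; exact: lipschitz_continuous (signedP theta).2.
apply: (@paired_average _ T R P {ffun J -> bool}
  (fun theta t => bochner_norm mu p (signed theta \- Fhat (obs (signed theta) t))%R)).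
- by rewrite card_ffun card_bool expn_gt0.
- by move=> theta; apply: (risk_measurable p1 sY eF) => //; exact: mobs.
- by move=> theta t; exact: bochner_norm_ge0.
- move=> t; pose U : {set J} := [set j | [forall i, bump j (pts t i) == 0]]%SET.
  exists (flip U) => [|theta]; first exact: flip_involutive.
  have -> : obs (signed (flip U theta)) t = obs (signed theta) t.
    apply: obs_local => i; apply: signed_bumps_flip => j.
    by rewrite inE => /forallP/(_ i)/eqP.
  apply: le_trans (bochner_triangle _ _ _ _ _ _) => //; last first.
    exact: (eF.1 _).1.
  apply: flip_distance => //.
  have UC : (#|~: U| <= m)%N.
    pose A i : {set J} := [set j | bump j (pts t i) != 0]%SET.
    have : ~: U \subset (\bigcup_(i < m) A i)%SET.
      apply/fintype.subsetP => j; rewrite !inE negb_forall => /existsP[i ji].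
      by apply/finset.bigcupP; exists i => //; rewrite inE.
    move=> /subset_leq_card/leq_trans; apply.
    apply: (@leq_trans (\sum_(i < m) 1)); last first.
      by rewrite big_const_ord iter_addn_0 mul1n.
    apply: (big_ind2 (fun (E : {set J}) n => #|E| <= n)%N) => [|E n E' n' En En'|i _].
    - by rewrite cards0.
    - by rewrite (leq_trans (leq_card_setU _ _).1)// leq_add.
    - apply/card_le1_eqP => j l; rewrite !inE => jz lz.
      exact: (bump_disjoint lz jz).
  move: UC mJ; rewrite -(cardsC U); lia.
- by move=> theta; exact: FS.
Qed.

End bump_lower_bound.

(** * Cells in the normalized coordinates *)

Section cell_bumps.
Context {R : realType} {X : hilbertType R}.
Variables (mu : probability (borel X) R) (lam : nat -> R) (phi : nat -> X).
Variables (a b : R) (k N : nat) (eta : R).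
Local Notation coord := (xi lam phi).
Local Notation cell := {ffun 'I_N -> 'I_k}.
Local Notation width := (a / k%:R).

Definition cell_center (j : nat) : R := - a + (2 * j%:R + 1) * width.

(** The distance to the complement of the cell, in the supremum norm of the
    first N normalized coordinates; it is not positive off the cell. *)
Definition cell_depth (j : cell) (x : X) : R :=
  \big[Num.min/width]_(i < N) (width - `|coord i x - cell_center (j i)|).

Definition cell_bump (j : cell) (x : X) : R := eta * Num.max 0 (cell_depth j x).

Definition cell_core (j : cell) : set (borel X) :=
  [set x | forall i : 'I_N, `|coord i x - cell_center (j i)| <= width / 2].

Hypotheses (a0 : 0 < a) (b0 : 0 < b) (k0 : (0 < k)%N) (eta0 : 0 < eta).

Let kR : 0 < k%:R :> R. Proof. by rewrite ltr0n. Qed.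
Let w0 : 0 < width. Proof. by rewrite divr_gt0. Qed.

Lemma cell_bump_bounds B : eta * width <= B ->
  forall j x, 0 <= cell_bump j x <= B.
Proof.
move=> etaB j x; rewrite mulr_ge0 ?le_max ?lexx ?(ltW eta0)//=.
apply: le_trans etaB; rewrite ler_pM2l// ge_max (ltW w0)/=.
exact: bigmin_le_id.
Qed.

Lemma cell_bump_neq0 j x : cell_bump j x != 0 ->
  forall i : 'I_N, `|coord i x - cell_center (j i)| < width.
Proof.
rewrite mulf_eq0 negb_or => /andP[_ d0] i.
have : 0 < cell_depth j x.
  by move: d0; case: (leP (cell_depth j x) 0); rewrite ?eqxx.
by move=> /bigmin_gtP[_ /(_ i isT)]; rewrite subr_gt0.
Qed.

(** The centers of two different cells are at least twice the width apart in
    some coordinate. *)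
Lemma cell_bump_disjoint j l x :
  cell_bump j x != 0 -> cell_bump l x != 0 -> j = l.
Proof.
move=> /cell_bump_neq0 jx /cell_bump_neq0 lx; apply/ffunP => i; apply/val_inj.
have sep (u v : nat) : `|coord i x - cell_center u| < width ->
    `|coord i x - cell_center v| < width -> (v <= u)%N.
  rewrite /cell_center !ltr_norml => /andP[_ h1] /andP[h2 _].
  rewrite leqNgt; apply/negP => uv.
  have : (u%:R + 1 : R) <= v%:R by rewrite natr1 ler_nat.
  move=> uv'; have := ler_wpM2r (ltW w0) uv'; move: h1 h2; nra.
by apply/eqP; rewrite eqn_leq !sep.
Qed.

Lemma min_dist (u v u' v' delta : R) : `|u - u'| <= delta ->
  `|v - v'| <= delta -> `|Num.min u v - Num.min u' v'| <= delta.
Proof.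
rewrite !ler_norml => /andP[h1 h2] /andP[h3 h4].
by case: (leP u v); case: (leP u' v') => *; apply/andP; split; lra.
Qed.

Lemma max_dist (u v u' v' delta : R) : `|u - u'| <= delta ->
  `|v - v'| <= delta -> `|Num.max u v - Num.max u' v'| <= delta.
Proof.
rewrite !ler_norml => /andP[h1 h2] /andP[h3 h4].
by case: (leP u v); case: (leP u' v') => *; apply/andP; split; lra.
Qed.

(** The normalized coordinate i stretches distances by 1 / sqrt (lam i), at most
    1 / Lam on the coordinates in use. *)
Lemma cell_bump_lipschitz (Lam L : R) : (forall i, `|phi i| = 1) ->
  0 < Lam -> (forall i, (i < N)%N -> Lam <= Num.sqrt (lam i)) ->
  eta <= L * Lam ->
  forall j x x', `|cell_bump j x - cell_bump j x'| <= L * `|x - x'|.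
Proof.
move=> phi1 Lam0 lamN etaL j x x'.
rewrite -mulrBr normrM gtr0_norm//.
have dd : 0 <= `|x - x'| / Lam by rewrite divr_ge0 ?(ltW Lam0).
apply: (@le_trans _ _ (eta * (`|x - x'| / Lam))); last first.
  rewrite mulrCA [leRHS]mulrC ler_wpM2l//.
  by rewrite ler_pdivrMr.
rewrite ler_pM2l//; apply: max_dist; first by rewrite subrr normr0.
apply: (big_ind2 (fun u v => `|u - v| <= `|x - x'| / Lam)) => [|u u' v v'|i _].
- by rewrite subrr normr0.
- exact: min_dist.
rewrite [X in `|X|](_ : _ = `|coord i x' - cell_center (j i)| -
  `|coord i x - cell_center (j i)|); last by ring.
apply: le_trans (ler_dist_dist _ _) _.
rewrite opprB addrA subrK distrC /xi -mulrBl -innerBl normrM.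
rewrite ler_pM//.
  by rewrite (le_trans (cauchy_schwarz _ _))// phi1 mulr1.
have sl := lamN i (ltn_ord i).
rewrite normfV ger0_norm ?sqrtr_ge0//.
by rewrite lef_pV2 ?posrE// (lt_le_trans Lam0).
Qed.

Lemma cell_core_bump j x : cell_core j x ->
  eta * (width / 2) <= cell_bump j x.
Proof.
move=> jx; rewrite ler_pM2l// le_max; apply/orP; right.
apply/bigmin_geP; split => [|i _]; first by rewrite ler_pdivrMr// ler_peMr ?(ltW w0)// ler1n.
by have := jx i; lra.
Qed.

Lemma cell_coreE j : cell_core j =
  \bigcap_(i in [set` seq_fset tt (iota 0 N)])
    (coord i @^-1` if insub i is Some i' then
       `[cell_center (j i') - width / 2, cell_center (j i') + width / 2]%classic
     else setT).
Proof.
apply/seteqP; split => x /= jx i /=.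
  move=> _; case: insubP => //= i' _ <-.
  by have := jx i'; rewrite in_itv/= ler_distl.
have iN : (i : nat) \in seq_fset tt (iota 0 N).
  by rewrite seq_fsetE mem_iota/= add0n ltn_ord.
by have := jx i iN; rewrite /= valK/= in_itv/= -ler_distl.
Qed.

Lemma measurable_coord i : measurable_fun [set: borel X] (coord i : borel X -> R).
Proof. by apply: measurable_funM => //; exact: measurable_inner. Qed.

Lemma measurable_cell_core j : measurable (cell_core j).
Proof.
rewrite cell_coreE; apply: fin_bigcap_measurable => // i _.
rewrite -[X in measurable X]setTI; apply: measurable_coord => //.
by case: insubP => // i' _ _; exact: measurable_itv.
Qed.

Hypothesis (coord_indep : independent_seq mu coord).
Hypothesis (coord_density : exists nu : nat -> R -> R, forall i,
  has_density mu (coord i) (nu i) /\ forall x, `|x| <= a -> b <= nu i x).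

(** The core of a cell is a box: by independence its mass is a product, each
    factor of which is at least b times the side of the box. *)
Lemma cell_core_mass j : (((a * b) ^+ N / #|{: cell}|%:R)%:E <= mu (cell_core j))%E.
Proof.
have [nu nuP] := coord_density.
rewrite cell_coreE coord_indep; last first.
  by move=> i; case: insubP => // i' _ _; exact: measurable_itv.
have cardN : size (seq_fset tt (iota 0 N)) = N.
  by rewrite size_seq_fset undup_id ?iota_uniq// size_iota.
have -> : (a * b) ^+ N / #|{: cell}|%:R = \prod_(i <- seq_fset tt (iota 0 N)) (b * width).
  rewrite big_const_seq count_predT cardN card_ffun !card_ord natrX -expr_div_n.
  by rewrite iter_mulr_1 mulrA (mulrC b).
rewrite -prodEFin big_seq [X in (_ <= X)%E]big_seq.
have bw0 : (0 <= (b * width)%:E)%E by rewrite lee_fin mulr_ge0 ?(ltW b0) ?(ltW w0).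
apply: (big_rec2 (fun u v => (0 <= v)%E /\ (v <= u)%E)
  (op1 := mule) (op2 := mule) _ _).2 => [|i u v + [v0 vu]]; first by rewrite lee01.
rewrite seq_fsetE mem_iota/= add0n => iN; split; first exact: mule_ge0.
apply: lee_pmul => //.
rewrite insubT/=; set i' := Sub i iN.
have [[mnu nu0 nuE] nub] := nuP i; rewrite nuE//.
set A := `[_, _]%classic.
have Aa x : A x -> `|x| <= a.
  rewrite /A/= in_itv/= /cell_center ler_norml => /andP[h1 h2].
  have := ltn_ord (j i'); rewrite -(ler_nat R) -natr1 => jk.
  have aw : a = k%:R * width by rewrite mulrC divfK// gt_eqF.
  have := ler_wpM2r (ltW w0) jk; rewrite -aw.
  have jw0 : 0 <= (j i')%:R * width by rewrite mulr_ge0// ltW.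
  by move: h1 h2 jw0 w0; move: width ((j i')%:R : R) => w z h1 h2 h3 h4 h5;
    apply/andP; split; nra.
apply: (@le_trans _ _ (\int[lebesgue_measure]_(x in A) b%:E)%E).
  have lA : (lebesgue_measure A = width%:E)%E.
    rewrite lebesgue_measure_itv/= lte_fin.
    have -> : cell_center (j i') - width / 2 < cell_center (j i') + width / 2.
      by rewrite ltrD2l gtrN// divr_gt0.
    by rewrite -EFinD; congr (_%:E); move: (cell_center _) width => c w; lra.
  by rewrite EFinM -lA -integral_cst//; exact: measurable_itv.
apply: ge0_le_integral => //.
- exact: measurable_itv.
- by move=> x _; rewrite lee_fin ltW.
- by apply/measurable_EFinP; apply: measurable_funTS.
- by move=> x /Aa /nub; rewrite lee_fin.
Qed.

End cell_bumps.

(** * Lower bound on both risks *)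

Section observations_measurability.
Context {R : realType} {X Y : hilbertType R} (sY : separable Y).
Variables (sigma : R) (m : nat).

Lemma measurable_responses (F : X -> Y) (x : m.-tuple (borel X)) :
  measurable_fun setT (responses sigma F x : m.-tuple (borel Y) -> _).
Proof.
apply/measurable_fun_tnthP => i /=.
rewrite (_ : _ \o _ = fun e =>
  ((F (tnth x i) : Y) + sigma *: (tnth e i : Y)) : borel Y); last first.
  by apply/funext => e; rewrite /= tnth_mktuple.
apply: (measurable_addV sY) => //; apply: (measurable_scaleV sigma).
exact: measurable_tnth.
Qed.

Lemma measurable_observations (F : X -> Y) :
  measurable_fun setT (F : borel X -> borel Y) ->
  measurable_fun setT (fun w : m.-tuple (borel X) * m.-tuple (borel Y) =>
    observations sigma F w.1 w.2).
Proof.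
move=> mF; apply/measurable_fun_tnthP => i /=.
rewrite (_ : _ \o _ = fun w => (tnth w.1 i,
    ((F (tnth w.1 i) : Y) + sigma *: (tnth w.2 i : Y)) : borel Y)); last first.
  by apply/funext => w; rewrite /= !tnth_mktuple.
have mt1 : measurable_fun setT
    (fun w : m.-tuple (borel X) * m.-tuple (borel Y) => tnth w.1 i).
  by apply: (measurableT_comp (measurable_tnth i)); exact: measurable_fst.
apply: measurable_fun_pair => //.
apply: (measurable_addV sY); first exact: (measurableT_comp mF).
apply: (measurable_scaleV sigma).
by apply: (measurableT_comp (measurable_tnth i)); exact: measurable_snd.
Qed.

Lemma responses_eq (F G : X -> Y) x (e : m.-tuple (borel Y)) :
  (forall i, F (tnth x i) = G (tnth x i)) ->
  responses sigma F x e = responses sigma G x e.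
Proof. by move=> FG; apply: eq_from_tnth => i; rewrite !tnth_mktuple FG. Qed.

Lemma observations_eq (F G : X -> Y) x (e : m.-tuple (borel Y)) :
  (forall i, F (tnth x i) = G (tnth x i)) ->
  observations sigma F x e = observations sigma G x e.
Proof. by move=> FG; rewrite /observations (responses_eq e FG). Qed.

End observations_measurability.

Section risk_lower_bound.
Context {R : realType} {X Y : hilbertType R}.
Variables (mu : probability (borel X) R) (gamma : probability (borel Y) R).
Variables (p B L sigma a b : R) (lam : nat -> R) (phi : nat -> X).
Hypotheses (p1 : 1 <= p) (sY : separable Y) (B0 : 0 < B) (L0 : 0 < L).
Hypothesis phi_unit : forall i, `|phi i| = 1.
Hypothesis coord_indep : independent_seq mu (xi lam phi).
Hypothesis coord_density : cond_iii_lower mu lam phi a b.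
Variables (y0 : Y) (y0_unit : `|y0| = 1).

(** The slope eta of the bumps in the normalized coordinates is limited by B,
    through their height, and by L, through the smallest eigenvalue in use. *)
Lemma risk_lower_bound (k N m : nat) (eta Lam : R) (M : nat -> \bar R) :
  (0 < k)%N -> (2 * m <= k ^ N)%N -> 0 < eta -> 0 < Lam ->
  (forall i, (i < N)%N -> Lam <= Num.sqrt (lam i)) ->
  eta * (a / k%:R) <= B -> eta <= L / 2 * Lam ->
  M = fixed_design_risk mu gamma sigma p (lip_class B L) \/
  M = random_design_risk mu gamma sigma p (lip_class B L) ->
  ((eta * (a / k%:R / 2) * ((a * b) ^+ N / 2) `^ p^-1)%:E <= M m)%E.
Proof.
move=> k0 mk eta0 Lam0 lamN etaB etaL Mrisk.
have [a0 b0 dens] := coord_density.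
have w0 : 0 < a / k%:R by rewrite divr_gt0// ltr0n.
have ab0 : 0 <= (a * b) ^+ N by rewrite exprn_ge0// mulr_ge0 ?(ltW a0) ?(ltW b0).
have h0 : 0 < eta * (a / k%:R / 2) by rewrite mulr_gt0// divr_gt0.
have cardJ : #|{: {ffun 'I_N -> 'I_k}}| = (k ^ N)%N.
  by rewrite card_ffun !card_ord.
have J0 : (0 < #|{: {ffun 'I_N -> 'I_k}}|)%N by rewrite cardJ expn_gt0 k0.
have mJ : (2 * m <= #|{: {ffun 'I_N -> 'I_k}}|)%N by rewrite cardJ.
have mlip F : lip_class B L F -> measurable_fun [set: borel X] (F : borel X -> borel Y).
  by move=> [_ FL]; apply: continuous_borel; exact: lipschitz_continuous FL.
pose bump (j : {ffun 'I_N -> 'I_k}) := cell_bump lam phi a eta j.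
have bounds j x : 0 <= bump j x <= B by exact: cell_bump_bounds.
have disjoint j l x : bump j x != 0 -> bump l x != 0 -> j = l.
  exact: cell_bump_disjoint.
have lipschitz j x x' : `|bump j x - bump j x'| <= L / 2 * `|x - x'|.
  by apply: (cell_bump_lipschitz a eta0 phi_unit Lam0 lamN).
pose core (j : {ffun 'I_N -> 'I_k}) := cell_core lam phi a j.
have mcore j : measurable (core j) by exact: measurable_cell_core.
have core_bump j x : core j x -> eta * (a / k%:R / 2) <= bump j x.
  exact: cell_core_bump.
have core_mass j : (((a * b) ^+ N / #|{: {ffun 'I_N -> 'I_k}}|%:R)%:E <= mu (core j))%E.
  exact: cell_core_mass.
have lower := bump_lower_bound p1 sY y0_unit (ltW B0) (ltW L0) bounds disjoint
  lipschitz h0 ab0 mcore core_bump core_mass.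
case: Mrisk => ->.
- apply: le_ereal_inf_tmp => _ [x _ <-]; apply: le_ereal_inf_tmp => _ [Fhat eF <-].
  apply: (@lower m _ _ _ _ _ (responses sigma ^~ x) (fun _ => tnth x) Fhat) => //.
  + by move=> F _; exact: measurable_responses.
  + by move=> F G e; exact: responses_eq.
  + by move=> F FF; apply: ereal_sup_ubound; exists F.
- apply: le_ereal_inf_tmp => _ [nu _ <-]; apply: le_ereal_inf_tmp => _ [Fhat eF <-].
  apply: (@lower m _ _ _ _ _ (fun F w => observations sigma F w.1 w.2)
    (fun w => tnth w.1) Fhat) => //.
  + by move=> F FF; apply: measurable_observations => //; exact: mlip.
  + by move=> F G e; exact: observations_eq.
  + by move=> F FF; apply: ereal_sup_ubound; exists F.
Qed.

End risk_lower_bound.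

(** * Second moments of sums of independent draws *)

Section second_moment.
Context d {T : measurableType d} {R : realType}.
Implicit Types (P : probability T R) (f : T -> R).

(** An upper bound v on the variance, rather than its value: this is what sums
    and scalings preserve and what the estimates consume. *)
Definition centered_variance P f (v : R) :=
  [/\ measurable_fun setT f, (\int[P]_x (f x)%:E = 0)%E &
      (\int[P]_x (f x ^+ 2)%:E <= v%:E)%E].

Lemma centered_variance_integrable P f v : centered_variance P f v ->
  P.-integrable setT (EFin \o f) /\ P.-integrable setT (EFin \o (fun x => f x ^+ 2)).
Proof.
move=> [mf _ fv].
have if2 : P.-integrable setT (EFin \o (fun x => f x ^+ 2)).
  apply/integrableP; split.
    by apply/measurable_EFinP; exact: measurable_funX.
  under eq_integral do rewrite /= ger0_norm ?sqr_ge0//.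
  by apply: le_lt_trans fv _; rewrite ltry.
split => //.
have if21 : P.-integrable setT (EFin \o (fun x => f x ^+ 2 + 1)).
  have i1 : P.-integrable setT (EFin \o cst 1).
    exact/finite_measure_integrable_cst.
  exact: (integrableD measurableT if2 i1).
apply: (le_integrable measurableT _ _ if21); first exact/measurable_EFinP.
move=> x _ /=; rewrite lee_fin [leRHS]ger0_norm ?addr_ge0 ?sqr_ge0// ler_norml.
by apply/andP; split; nra.
Qed.

Lemma centered_varianceZ P f v c : centered_variance P f v ->
  centered_variance P (fun x => c * f x) (c ^+ 2 * v).
Proof.
move=> fv; have [if1 _] := centered_variance_integrable fv.
have [mf f0 f2v] := fv; split; first exact: measurable_funM.
  rewrite (eq_integral (fun x => c%:E * (f x)%:E)%E)//.
  by rewrite integralZl// f0 mule0.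
rewrite (eq_integral (fun x => (c ^+ 2)%:E * (f x ^+ 2)%:E)%E); last first.
  by move=> x _; rewrite exprMn EFinM.
rewrite ge0_integralZl_EFin ?sqr_ge0//.
- by rewrite [leRHS]EFinM lee_wpmul2l// lee_fin sqr_ge0.
- by move=> x _; rewrite lee_fin sqr_ge0.
- by apply/measurable_EFinP; exact: measurable_funX.
Qed.

Lemma centered_variance_shift P f v s : centered_variance P f v ->
  (\int[P]_x ((f x + s) ^+ 2)%:E <= v%:E + (s ^+ 2)%:E)%E.
Proof.
move=> fvar; have [if1 if2] := centered_variance_integrable fvar.
have [mf f0 fv] := fvar.
have ic c : P.-integrable setT (EFin \o cst c).
  exact/finite_measure_integrable_cst.
have i2f : P.-integrable setT (EFin \o (fun x => 2 * s * f x)).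
  have := integrableZl measurableT (2 * s) if1.
  by apply: eq_integrable => // x _; rewrite /= EFinM.
pose g x := 2 * s * f x + s ^+ 2.
have ig : P.-integrable setT (EFin \o g).
  exact: (integrableD measurableT i2f (ic (s ^+ 2))).
have int_g : (\int[P]_x (g x)%:E = (s ^+ 2)%:E)%E.
  transitivity (\int[P]_x (2 * s * f x)%:E + \int[P]_x (s ^+ 2)%:E)%E.
    exact: (integralD_EFin measurableT i2f (ic (s ^+ 2))).
  rewrite integral_cst//= probability_setT mule1.
  rewrite (eq_integral (fun x => (2 * s)%:E * (f x)%:E)%E)//.
  by rewrite integralZl// f0 mule0 add0e.
rewrite (eq_integral (fun x => (f x ^+ 2)%:E + (g x)%:E)%E); last first.
  by move=> x _; rewrite -EFinD /g; congr (_%:E); ring.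
apply: (@le_trans _ _ (\int[P]_x (f x ^+ 2)%:E + \int[P]_x (g x)%:E)%E).
  by rewrite le_eqVlt; apply/orP; left; apply/eqP; exact: (integralD_EFin measurableT if2 ig).
by rewrite int_g leeD2r.
Qed.

(** Integrating out the first draw, with the others fixed, kills the cross term
    with their sum; Tonelli then gives the induction step. *)
Lemma iid_second_moment P m (f : 'I_m -> T -> R) (v : 'I_m -> R) :
  (forall i, centered_variance P (f i) (v i)) ->
  (\int[iid P m]_t ((\sum_i f i (tnth t i)) ^+ 2)%:E <= (\sum_i v i)%:E)%E.
Proof.
elim: m f v => [|m IHm] f v fv.
  rewrite (eq_integral (cst 0%E)).
    by rewrite integral0 big_ord0.
  by move=> t _; rewrite big_ord0 expr0n.
have msum n (g : 'I_n -> T -> R) : (forall i, measurable_fun setT (g i)) ->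
    measurable_fun setT (fun t : n.-tuple T => \sum_i g i (tnth t i)).
  move=> mg; apply: measurable_sum => i.
  by apply: measurableT_comp => //; exact: measurable_tnth.
have mf i : measurable_fun setT (f i) by have [] := fv i.
rewrite /= ge0_integral_distribution => [|| t]; last 2 first.
- by apply/measurable_EFinP; apply: measurable_funX; exact: msum.
- by rewrite lee_fin sqr_ge0.
pose S (t : m.-tuple T) := \sum_(i < m) f (lift ord0 i) (tnth t i).
have mS : measurable_fun setT S by exact: (msum _ (fun i => f (lift ord0 i))).
rewrite (eq_integral (fun x => ((f ord0 x.1 + S x.2) ^+ 2)%:E)); last first.
  move=> x _ /=; rewrite big_ord_recl /=; congr ((_ + _) ^+ 2)%:E.
  by apply: eq_bigr => i _; rewrite tnthS.
rewrite fubini_tonelli2//=; last 2 first.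
- apply/measurable_EFinP; apply: measurable_funX; apply: measurable_funD.
    by apply: (measurableT_comp (mf ord0)); exact: measurable_fst.
  by apply: (measurableT_comp mS); exact: measurable_snd.
- by move=> x; rewrite lee_fin sqr_ge0.
apply: (@le_trans _ _ (\int[iid P m]_t ((v ord0)%:E + (S t ^+ 2)%:E))%E).
  apply: ge0_le_integral_nonmeasurable => t.
    by apply: integral_ge0 => x _; rewrite lee_fin sqr_ge0.
  by rewrite /fubini_G/=; exact: (centered_variance_shift (S t) (fv ord0)).
have v0 : 0 <= v ord0.
  have [_ _] := fv ord0; rewrite -lee_fin; apply: le_trans.
  by apply: integral_ge0 => x _; rewrite lee_fin sqr_ge0.
rewrite ge0_integralD//; last 2 first.
- by move=> t _; rewrite lee_fin sqr_ge0.
- by apply/measurable_EFinP; exact: measurable_funX.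
rewrite integral_cst// [X in (_ * X)%E](_ : _ = 1%E); last exact: probability_setT.
rewrite mule1 big_ord_recl EFinD leeD2l//.
exact: (IHm (fun i => f (lift ord0 i)) (fun i => v (lift ord0 i))).
Qed.

End second_moment.

Section noise_energy.
Context {R : realType} {V : hilbertType R} (sV : separable V).
Implicit Types (gamma : probability (borel V) R) (C : V -> V).

Lemma inner_second_moment gamma C y : has_mean gamma 0 ->
  covariance_operator gamma C ->
  (\int[gamma]_x (inner (x : V) y ^+ 2)%:E = (inner (C y) y)%:E)%E.
Proof.
move=> m0 covC; rewrite -(covC y y) covariance.unlock m0 inner0l expectation.unlock.
apply: eq_integral => x _.
transitivity (((inner (x : V) y - 0) * (inner (x : V) y - 0))%:E) => //.
by rewrite subr0 -expr2.
Qed.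

Lemma centered_variance_inner gamma C y : has_mean gamma 0 ->
  covariance_operator gamma C ->
  centered_variance gamma (fun x : borel V => inner (x : V) y) (inner (C y) y).
Proof.
move=> m0 covC; split; first exact: measurable_inner.
  by have := m0 y; rewrite expectation.unlock inner0l.
by rewrite (inner_second_moment _ m0 covC).
Qed.

(** The trace condition, read along a sequence of coordinates. *)
Definition noise_coordinates gamma (e : nat -> V) (v : nat -> R) :=
  [/\ padded_orthonormal e, spanning e,
   forall k, centered_variance gamma (fun x : borel V => inner (x : V) (e k)) (v k),
   forall k, 0 <= v k & (\sum_(k <oo) (v k)%:E <= 1)%E].

Lemma gaussian_noise_coordinates gamma : gaussian_noise gamma ->
  exists e v, noise_coordinates gamma e v.
Proof.
move=> [C [_ m0 covC [I [e [eb trC]]]]].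
have C0 x : 0 <= inner (C x) x.
  rewrite -lee_fin -(inner_second_moment x m0 covC).
  by apply: integral_ge0 => y _; rewrite lee_fin sqr_ge0.
have [e' [e'o e's e'sum]] := orthonormal_basis_seq sV eb.
exists e', (fun k => inner (C (e' k)) (e' k)); split => //.
  by move=> k; exact: centered_variance_inner.
by rewrite (e'sum (fun x => (inner (C x) x)%:E)) ?trC// inner0r.
Qed.

Lemma gaussian_noise_unit gamma : gaussian_noise gamma ->
  exists y0 : V, `|y0| = 1.
Proof.
move=> [C [_ _ _ [I [e [[eo _] trC]]]]].
have [[i _]|I0] := pselect (exists i : I, True); last first.
  move: trC; rewrite (_ : [set: I] = set0) ?esum_set0.
    by move=> /eqP; rewrite eqe eq_sym oner_eq0.
  by apply/seteqP; split => // i _; case: I0; exists i.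
exists (e i); apply/eqP.
rewrite -(@eqrXn2 _ 2)// expr1n -inner_norm eo eqxx.
by [].
Qed.

(** In each coordinate the variances of independent draws add up, and the trace
    bounds by 1 the sum over the coordinates. *)
Lemma noise_energy gamma e v m (w : 'I_m -> R) : noise_coordinates gamma e v ->
  (\int[iid gamma m]_t
     \sum_(k <oo) ((\sum_i w i * inner (tnth t i : V) (e k)) ^+ 2)%:E <=
   (\sum_i w i ^+ 2)%:E)%E.
Proof.
move=> [eo es ev v0 v1].
have mw k i : measurable_fun setT (fun x : borel V => w i * inner (x : V) (e k)).
  by apply: measurable_funM => //; exact: measurable_inner.
rewrite integral_nneseries//; last 2 first.
- move=> k; apply/measurable_EFinP; apply: measurable_funX.
  apply: measurable_sum => i; apply: (measurableT_comp (mw k i)).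
  exact: measurable_tnth.
- by move=> k t _; rewrite lee_fin sqr_ge0.
have W0 : 0 <= \sum_i w i ^+ 2 by apply: sumr_ge0 => i _; exact: sqr_ge0.
apply: (@le_trans _ _ (\sum_(k <oo) (\sum_i w i ^+ 2)%:E * (v k)%:E)%E).
  apply: lee_nneseries => [k _ _|k _].
    by apply: integral_ge0 => t _; rewrite lee_fin sqr_ge0.
  rewrite -EFinM mulr_suml.
  apply: (@iid_second_moment _ _ _ gamma m
    (fun i (x : borel V) => w i * inner (x : V) (e k))) => i.
  exact: centered_varianceZ.
rewrite nneseriesZl; last by move=> k _; rewrite lee_fin.
by rewrite -[leRHS]mule1 lee_wpmul2l.
Qed.

End noise_energy.

(** * Upper bound: averaging the responses over a grid *)

Lemma mnormalizeE (R : realType) d (T : measurableType d)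
    (mu : {measure set T -> \bar R}) (P : probability T R) (r : R) (A : set T) :
  mu setT = r%:E -> r != 0 -> mnormalize mu P A = (mu A * (r^-1)%:E)%E.
Proof. by move=> muT r0; rewrite /mnormalize muT eqe (negbTE r0). Qed.

Lemma uniform_measure_on (R : realType) d (T : measurableType d) (J : finType)
    (g : J -> T) : injective g -> (0 < #|J|)%N ->
  exists nu : probability T R,
    forall j, nu [set g j] = (#|J|%:R^-1)%:E.
Proof.
move=> gi /card_gt0P[j0 _].
pose pt n := g (nth j0 (enum J) n).
pose mu : {measure set T -> \bar R} := msum (fun n => \d_(pt n) : {measure set T -> \bar R}) #|J|.
exists (mnormalize mu (\d_(pt 0))) => j.
have muT : mu setT = #|J|%:R%:E.
  transitivity (\sum_(i < #|J|) (1%:E : \bar R))%E.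
    by apply: eq_bigr => i _; exact: diracT.
  by rewrite sumEFin sumr_const card_ord.
have J0 : #|J|%:R != 0 :> R.
  by rewrite pnatr_eq0 -lt0n; apply/card_gt0P; exists j0.
apply: (eq_trans (mnormalizeE (\d_(pt 0)) [set g j] muT J0)).
suff -> : mu [set g j] = 1%E by rewrite mul1e.
transitivity (\sum_(0 <= n < size (enum J)) (\1_[set g j] (pt n) : R)%:E)%E.
  by rewrite big_mkord -cardE.
rewrite -(big_nth j0 xpredT (fun i => (\1_[set g j] (g i) : R)%:E)).
rewrite big_enum (bigD1 j)//= indicE mem_set// big1 ?adde0// => i ij.
by rewrite indicE memNset// => /gi /eqP; rewrite (negbTE ij).
Qed.

Lemma indic_variance (R : realType) d (T : measurableType d)
    (P : probability T R) (A : set T) (r c : R) :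
  measurable A -> P A = (r^-1)%:E -> 1 <= r -> 0 < c ->
  centered_variance P (fun x => r / c * \1_A x - c^-1) ((r / c) ^+ 2).
Proof.
move=> mA PA r1 c0; have r0 : 0 < r by rewrite (lt_le_trans _ r1).
have mi : measurable_fun setT (fun x => r / c * \1_A x : R).
  by apply: measurable_funM => //; exact: measurable_indic.
split; first exact: measurable_funB.
  have ic : P.-integrable setT (EFin \o cst (- c^-1)).
    exact/finite_measure_integrable_cst.
  have ii : P.-integrable setT (EFin \o (fun x => r / c * \1_A x)).
    by have := integrableZl measurableT (r / c) (integrable_indic P mA).
  rewrite (_ : (\int[P]_x _)%E =
      (\int[P]_x (r / c * \1_A x)%:E + \int[P]_x (- c^-1)%:E)%E); last first.
    exact: (integralD_EFin measurableT ii ic).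
  rewrite integral_cst//= probability_setT mule1.
  rewrite (eq_integral (fun x => (r / c)%:E * (\1_A x)%:E)%E)//.
  rewrite ge0_integralZl_EFin//.
  - rewrite (_ : (\int[P]_x (\1_A x)%:E)%E = (r^-1)%:E); last first.
      by rewrite integral_indic// setIT; exact: PA.
    by rewrite -EFinM -EFinD; congr (_%:E); field; rewrite !gt_eqF.
  - by apply/measurable_EFinP; exact: measurable_indic.
  - by rewrite divr_ge0// ltW.
apply: (@le_trans _ _ (\int[P]_x ((r / c) ^+ 2)%:E)%E); last first.
  by rewrite integral_cst//= probability_setT mule1.
apply: ge0_le_integral_nonmeasurable => x; first by rewrite lee_fin sqr_ge0.
have h1 : 0 <= c^-1 ^+ 2 * (2 * r - 1) by rewrite mulr_ge0 ?sqr_ge0//; lra.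
have h2 : 0 <= c^-1 ^+ 2 * (r ^+ 2 - 1) by rewrite mulr_ge0 ?sqr_ge0//; nra.
by rewrite lee_fin indicE; case: (x \in A); rewrite ?mulr1 ?mulr0; lra.
Qed.

Section grid_estimator.
Context {R : realType} {X Y : hilbertType R}.
Variables (mu : probability (borel X) R) (p : R) (J : finType) (m : nat).
Hypotheses (p1 : 1 <= p) (sY : separable Y).
Variables (idx : X -> J) (g : J -> X).
Hypothesis measurable_idx :
  forall j, measurable ([set x | idx x = j] : set (borel X)).
Local Notation K := (#|J|%:R : R).

Lemma cellwise_bochner (z : J -> Y) : bochner_space mu p (z \o idx).
Proof.
split.
  move=> _ A mA; rewrite setTI.
  rewrite (_ : _ @^-1` A = \bigcup_(j in [set j | A (z j)])
      ([set x | idx x = j] : set (borel X))).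
    by apply: fin_bigcup_measurable => //; exact: finite_finset.
  apply/seteqP; split => [x Ax|x [j Aj /= xj]]; first by exists (idx x).
  by rewrite xj.
apply: (@le_lt_trans _ _ (\sum_j `|z j|)%:E); last by rewrite ltry.
apply: bochner_norm_bounded => // x.
by rewrite /= (bigD1 (idx x))//= lerDl sumr_ge0.
Qed.

(** Under the uniform design the weights sum to one in expectation. *)
Definition grid_weight (j : J) (x : X) : R := K / m%:R * \1_[set g j] x.

Definition cell_average (t : m.-tuple (borel X * borel Y)%type) (j : J) : Y :=
  \sum_(i < m) grid_weight j (tnth t i).1 *: ((tnth t i).2 : Y).

Definition grid_estimator (t : m.-tuple (borel X * borel Y)%type) : X -> Y :=
  cell_average t \o idx.

Lemma measurable_weight j :
  measurable_fun setT (grid_weight j : borel X -> R).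
Proof.
apply: measurable_funM => //; apply: measurable_indic; exact: borel_set1.
Qed.

Lemma measurable_cell_average j :
  measurable_fun setT (fun t => cell_average t j : borel Y).
Proof.
apply: (measurable_sumV sY) => i.
rewrite (_ : (fun t => _) = (fun t =>
    if ((tnth t i).1 : X) \in [set g j] then (K / m%:R) *: ((tnth t i).2 : Y)
    else 0 : borel Y)); last first.
  apply/funext => t; rewrite /grid_weight indicE.
  by case: ifPn => _; rewrite ?mulr1 ?mulr0 ?scale0r.
have mt : measurable_fun setT
    (fun t : m.-tuple (borel X * borel Y)%type => tnth t i) by exact: measurable_tnth.
apply: measurable_fun_ifT => //.
  apply: (measurable_fun_bool true).
  rewrite setTI (_ : _ @^-1` _ = (fun t : m.-tuple (borel X * borel Y)%type =>
    (tnth t i).1) @^-1` [set g j]).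
    rewrite -[X in measurable X]setTI.
    apply: (measurableT_comp measurable_fst mt) => //; exact: borel_set1.
  by apply/seteqP; split => t /= => [/set_mem|/mem_set].
apply: measurable_scaleV; exact: (measurableT_comp measurable_snd mt).
Qed.

(** Measurability in the data: the estimator is a continuous function, from a
    finite power of Y to L^p, of the measurable cell averages. *)
Lemma grid_estimatorP : estimator mu p grid_estimator.
Proof.
split => [t|U oU]; first exact: cellwise_bochner.
apply: (measurable_open_preimage sY (W := fun v => U (v \o idx))
  measurable_cell_average) => v Uv.
have [r r0 rU] := oU _ (cellwise_bochner v) Uv.
exists (r / 2) => [|v' vv']; first by rewrite divr_gt0.
apply: rU; first exact: cellwise_bochner.
apply: (@le_lt_trans _ _ (r / 2)%:E); last first.
  by rewrite lte_fin ltr_pdivrMr// ltr_pMr// ltr1n.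
by apply: bochner_norm_bounded => // x; rewrite /= distrC ltW.
Qed.

End grid_estimator.

Section grid_risk.
Context {R : realType} {X Y : hilbertType R}.
Variables (mu : probability (borel X) R) (gamma : probability (borel Y) R).
Variables (p B L sigma : R) (J : finType) (m : nat).
Hypotheses (p1 : 1 <= p) (sY : separable Y).
Hypotheses (B0 : 0 < B) (L0 : 0 < L) (sigma0 : 0 < sigma) (m0 : (0 < m)%N).
Variables (idx : X -> J) (g : J -> X).
Hypothesis measurable_idx :
  forall j, measurable ([set x | idx x = j] : set (borel X)).
Hypotheses (g_inj : injective g) (J0 : (0 < #|J|)%N).
Variables (bad : set (borel X)) (c1 c2 : R).
Hypothesis measurable_bad : measurable bad.
Hypothesis c1_ge0 : 0 <= c1.
Hypothesis near_grid : forall x, ~ bad x -> `|x - g (idx x)| <= c1.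
Hypothesis bad_mass : (mu bad `^ p^-1 <= c2%:E)%E.
Variables (e : nat -> Y) (v : nat -> R).
Hypothesis noise : noise_coordinates gamma e v.
Variable nu : probability (borel X) R.
Hypothesis nu_uniform : forall j, nu [set g j] = (#|J|%:R^-1)%:E.

Local Notation K := (#|J|%:R : R).
Local Notation weight := (grid_weight m g).
(** The order of the standard deviation of both the weights and the noise. *)
Let q : R := K / Num.sqrt m%:R.

Let K0 : 0 < K. Proof. by rewrite ltr0n. Qed.
Let mR : 0 < m%:R :> R. Proof. by rewrite ltr0n. Qed.
Let q0 : 0 < q. Proof. by rewrite divr_gt0// sqrtr_gt0. Qed.
Let q2 : q ^+ 2 = m%:R * (K / m%:R) ^+ 2.
Proof.
rewrite /q exprMn exprVn sqr_sqrtr ?ler0n// exprMn exprVn.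
by field; rewrite gt_eqF.
Qed.

Let weight_ge0 j x : 0 <= weight j x.
Proof. by rewrite mulr_ge0// divr_ge0 ?ltW. Qed.

Let weight_le j x : weight j x <= K / m%:R.
Proof.
by rewrite ler_piMr ?divr_ge0 ?ler0n// indicE; case: (x \in _); rewrite ?lexx ?ler01.
Qed.

(** Half the sum of the scale and the rescaled square bounds the absolute
    value, and the squares are what can be integrated. *)
Definition cell_error (j : J) (x : m.-tuple (borel X)) (eps : m.-tuple (borel Y)) :=
  ((B * (q / 2 + (2 * q)^-1 * (\sum_(i < m) weight j (tnth x i) - 1) ^+ 2)
      + sigma * (q / 2))%:E +
   (sigma / (2 * q))%:E * \sum_(k <oo)
     ((\sum_(i < m) weight j (tnth x i) * inner (tnth eps i : Y) (e k)) ^+ 2)%:E)%E.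

Let amgm (u : R) : u <= q / 2 + (2 * q)^-1 * u ^+ 2.
Proof.
have qn0 : q != 0 by rewrite gt_eqF.
rewrite -subr_ge0 [leRHS](_ : _ = (2 * q)^-1 * (u - q) ^+ 2).
  by rewrite mulr_ge0 ?sqr_ge0// invr_ge0 mulr_ge0// ltW.
by field.
Qed.

Lemma cell_errorP F j x eps : lip_class B L F ->
  ((`|cell_average g (observations sigma F x eps) j - F (g j)|)%:E <=
    cell_error j x eps)%E.
Proof.
move=> [FB _]; pose W := \sum_(i < m) weight j (tnth x i).
pose N := \sum_(i < m) weight j (tnth x i) *: (tnth eps i : Y).
have -> : cell_average g (observations sigma F x eps) j = W *: F (g j) + sigma *: N.
  rewrite scaler_suml scaler_sumr -big_split/=; apply: eq_bigr => i _.
  rewrite tnth_mktuple/= tnth_mktuple scalerDr !scalerA mulrC; congr (_ + _).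
  rewrite /grid_weight indicE; case: (boolP (_ \in _)) => [|_]; last by rewrite mulr0 !scale0r.
  by rewrite inE => ->.
have normN : ((`|N|)%:E <= (q / 2)%:E + ((2 * q)^-1)%:E *
    \sum_(k <oo) ((\sum_(i < m) weight j (tnth x i) *
      inner (tnth eps i : Y) (e k)) ^+ 2)%:E)%E.
  apply: (@le_trans _ _ ((q / 2)%:E + ((2 * q)^-1)%:E * (`|N| ^+ 2)%:E)%E).
    by rewrite -EFinM -EFinD lee_fin; exact: amgm.
  rewrite leeD2l// lee_wpmul2l//.
    by rewrite lee_fin invr_ge0 mulr_ge0// (ltW q0).
  have [eo es _ _ _] := noise; apply: le_trans (parseval_le N eo es) _.
  rewrite le_eqVlt; apply/orP; left; apply/eqP; apply: eq_eseriesr => k _.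
  by rewrite inner_suml; congr ((_ ^+ 2)%:E); apply: eq_bigr => i _; rewrite innerZl.
apply: (@le_trans _ _ (B * `|W - 1| + sigma * `|N|)%:E).
  rewrite lee_fin addrAC -[X in _ - X]scale1r -scalerBl.
  apply: le_trans (ler_normD _ _) _.
  by rewrite !normrZ (gtr0_norm sigma0) lerD2r mulrC ler_wpM2r.
rewrite EFinD /cell_error EFinD -addeA leeD//.
  rewrite lee_fin (ler_wpM2l (ltW B0))//.
  by have := amgm `|W - 1|; rewrite real_normK ?num_real.
rewrite [X in (_ + X)%E](_ : _ = (sigma%:E * (((2 * q)^-1)%:E * \sum_(k <oo)
    ((\sum_(i < m) weight j (tnth x i) * inner (tnth eps i : Y) (e k)) ^+ 2)%:E))%E).
  by rewrite EFinM [X in (X + _)%E]EFinM -muleDr// ?lee_wpmul2l// ?lee_fin ?(ltW sigma0).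
by rewrite muleA.
Qed.

Local Notation Fhat := (grid_estimator idx g).
Local Notation base := (L * c1 + 2 * B * c2).
Local Notation level := (base + K * ((B + sigma) * q)).

Let c2_ge0 : 0 <= c2.
Proof. by rewrite -lee_fin (le_trans _ bad_mass)// poweR_ge0. Qed.

Let qi0 : 0 <= (2 * q)^-1.
Proof. by rewrite invr_ge0 mulr_ge0// (ltW q0). Qed.

Let base_ge0 : 0 <= base.
Proof. by rewrite addr_ge0// !mulr_ge0// ltW. Qed.

Lemma cell_error_ge0 j x eps : (0 <= cell_error j x eps)%E.
Proof.
rewrite adde_ge0 ?mule_ge0//.
- rewrite lee_fin addr_ge0 ?mulr_ge0 ?(ltW B0) ?(ltW sigma0) ?invr_ge0 ?(ltW q0)//.
  by rewrite addr_ge0 ?(mulr_ge0 qi0 (sqr_ge0 _))// mulr_ge0 ?invr_ge0 ?(ltW q0).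
- by rewrite lee_fin mulr_ge0 ?(ltW sigma0).
- by apply: nneseries_ge0 => k _ _; rewrite lee_fin sqr_ge0.
Qed.

(** Between x and its grid point F moves by at most L c1 off the bad set, and by
    at most 2 B on it; the bad set enters through the norm of its indicator. *)
Lemma grid_loss_le F x eps : lip_class B L F ->
  (bochner_norm mu p (F \- Fhat (observations sigma F x eps))%R <=
   base%:E + \sum_j cell_error j x eps)%E.
Proof.
move=> FF; have [FB FL] := FF.
pose Z := cell_average g (observations sigma F x eps).
pose D j := `|Z j - F (g j)|.
apply: (@le_trans _ _ (base%:E + \sum_j (D j)%:E)%E); last first.
  by rewrite leeD2l//; apply: lee_sum => j _; exact: cell_errorP.
pose s := L * c1 + \sum_j D j.
have D0 j : 0 <= D j by exact: normr_ge0.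
have s0 : 0 <= s by rewrite addr_ge0 ?mulr_ge0 ?(ltW L0) ?sumr_ge0.
apply: (@le_trans _ _ 'N[mu]_p%:E[EFin \o (cst s \+ (fun x => 2 * B * \1_bad x))%R]%E).
  apply: le_Lnorm => // z; rewrite /= normr_id ger0_norm; last first.
    by rewrite addr_ge0// mulr_ge0 ?mulr_ge0 ?(ltW B0).
  rewrite -(subrKA (F (g (idx z)))) (le_trans (ler_normD _ _))//.
  have DD : `|F (g (idx z)) - Z (idx z)| <= \sum_j D j.
    by rewrite distrC (bigD1 (idx z))//= lerDl sumr_ge0.
  rewrite /s addrAC lerD// indicE.
  case: (boolP (z \in bad)) => [_|/negP]; last first.
    rewrite mulr0 addr0 => zb; apply: (le_trans (FL _ _)).
    rewrite ler_wpM2l ?(ltW L0)//; apply: near_grid => zb'.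
    by apply: zb; rewrite inE.
  rewrite mulr1 (le_trans (ler_normB _ _))// ler_wpDl ?mulr_ge0 ?(ltW L0)//.
  by rewrite mulr_natl mulr2n lerD.
apply: (le_trans (minkowski_EFin mu _ _ p1)) => //.
  by apply: measurable_funM => //; exact: measurable_indic.
rewrite Lnorm_cst// Lnorm_indic ?mulr_ge0 ?(ltW B0)//.
rewrite [leRHS](_ : _ = s%:E + (2 * B * c2)%:E)%E; last first.
  by rewrite sumEFin -!EFinD /s; congr (_%:E); ring.
rewrite leeD2l//.
by rewrite [leRHS]EFinM lee_wpmul2l// lee_fin mulr_ge0 ?(ltW B0).
Qed.

Lemma weight_variance j :
  centered_variance nu (fun x => weight j x - m%:R^-1) ((K / m%:R) ^+ 2).
Proof.
apply: indic_variance => //; first exact: borel_set1.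
by rewrite ler1n.
Qed.

Lemma measurable_cell_error j : measurable_fun setT
  (fun w : m.-tuple (borel X) * m.-tuple (borel Y) => cell_error j w.1 w.2).
Proof.
have mw i : measurable_fun setT
    (fun w : m.-tuple (borel X) * m.-tuple (borel Y) => weight j (tnth w.1 i)).
  apply: (measurableT_comp (measurable_weight m g j)).
  by apply: (measurableT_comp (measurable_tnth i)); exact: measurable_fst.
have me i k : measurable_fun setT
    (fun w : m.-tuple (borel X) * m.-tuple (borel Y) => inner (tnth w.2 i : Y) (e k)).
  apply: (measurableT_comp (measurable_inner (e k))).
  by apply: (measurableT_comp (measurable_tnth i)); exact: measurable_snd.
apply: emeasurable_funD.
  apply/measurable_EFinP; apply: measurable_funD => //.
  apply: measurable_funM => //; apply: measurable_funD => //.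
  apply: measurable_funM => //; apply: measurable_funX.
  by apply: measurable_funB => //; apply: measurable_sum => i; exact: mw.
apply: emeasurable_funM => //.
apply: ge0_emeasurable_sum => [k w _ _|k _]; first by rewrite lee_fin sqr_ge0.
apply/measurable_EFinP; apply: measurable_funX; apply: measurable_sum => i.
by apply: measurable_funM; [exact: mw|exact: me].
Qed.

Let sum_weight2 j x : \sum_(i < m) weight j (tnth x i) ^+ 2 <= q ^+ 2.
Proof.
apply: (@le_trans _ _ (\sum_(i < m) (K / m%:R) ^+ 2)); last first.
  by rewrite sumr_const card_ord q2 -[leLHS]mulr_natl.
by apply: ler_sum => i _; rewrite lerXn2r ?nnegrE ?weight_ge0// (le_trans (weight_ge0 _ _) (weight_le _ _)).
Qed.

Lemma cell_error_noise_mean j x :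
  (\int[iid gamma m]_eps cell_error j x eps <=
   (B * (q / 2 + (2 * q)^-1 * (\sum_(i < m) weight j (tnth x i) - 1) ^+ 2)
    + sigma * q)%:E)%E.
Proof.
have qn0 : q != 0 by rewrite gt_eqF.
have ms : measurable_fun setT (fun eps : m.-tuple (borel Y) => (\sum_(k <oo)
    ((\sum_(i < m) weight j (tnth x i) * inner (tnth eps i : Y) (e k)) ^+ 2)%:E)%E).
  apply: ge0_emeasurable_sum => [k w _ _|k _]; first by rewrite lee_fin sqr_ge0.
  apply/measurable_EFinP; apply: measurable_funX; apply: measurable_sum => i.
  apply: measurable_funM => //; apply: (measurableT_comp (measurable_inner (e k))).
  exact: measurable_tnth.
have s0 (eps : m.-tuple (borel Y)) : (0 <= \sum_(k <oo)
    ((\sum_(i < m) weight j (tnth x i) * inner (tnth eps i : Y) (e k)) ^+ 2)%:E)%E.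
  by apply: nneseries_ge0 => k _ _; rewrite lee_fin sqr_ge0.
have sq0 : 0 <= sigma / (2 * q) by rewrite mulr_ge0 ?(ltW sigma0).
rewrite ge0_integralD//; last 3 first.
- move=> eps _; rewrite lee_fin addr_ge0// mulr_ge0 ?(ltW B0) ?(ltW sigma0) ?divr_ge0 ?(ltW q0)//.
  by rewrite addr_ge0 ?(mulr_ge0 qi0 (sqr_ge0 _))// divr_ge0 ?(ltW q0).
- by move=> eps _; rewrite mule_ge0 ?lee_fin.
- exact: emeasurable_funM.
rewrite integral_cst//= probability_setT mule1 ge0_integralZl_EFin//.
apply: (@le_trans _ _ ((B * (q / 2 + (2 * q)^-1 *
    (\sum_(i < m) weight j (tnth x i) - 1) ^+ 2) + sigma * (q / 2))%:E +
    (sigma / (2 * q))%:E * (q ^+ 2)%:E)%E).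
  rewrite leeD2l// lee_wpmul2l// (le_trans (noise_energy _ noise))//.
  by rewrite lee_fin; exact: sum_weight2.
rewrite -EFinM -EFinD lee_fin le_eqVlt; apply/orP; left; apply/eqP.
by rewrite -addrA; congr (_ + _); field.
Qed.

Lemma cell_error_mean j :
  (\int[iid nu m]_x \int[iid gamma m]_eps cell_error j x eps <=
   ((B + sigma) * q)%:E)%E.
Proof.
have qn0 : q != 0 by rewrite gt_eqF.
pose f (i : 'I_m) (x : borel X) : R := weight j x - m%:R^-1.
have sumf (x : m.-tuple (borel X)) :
    \sum_(i < m) weight j (tnth x i) - 1 = \sum_i f i (tnth x i).
  rewrite sumrB sumr_const card_ord -[_ *+ m]mulr_natr mulVf//.
  by rewrite gt_eqF.
have fvar i : centered_variance nu (f i) ((K / m%:R) ^+ 2) by exact: weight_variance.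
have mf i : measurable_fun setT (f i) by have [] := fvar i.
pose c := B * (q / 2) + sigma * q.
apply: (@le_trans _ _ (\int[iid nu m]_x (c%:E + (B / (2 * q))%:E *
    ((\sum_i f i (tnth x i)) ^+ 2)%:E))%E).
  apply: ge0_le_integral_nonmeasurable => x.
    by apply: integral_ge0 => eps _; exact: cell_error_ge0.
  apply: le_trans (cell_error_noise_mean j x) _.
  rewrite -EFinM -EFinD lee_fin -sumf le_eqVlt; apply/orP; left; apply/eqP.
  by rewrite /c; ring.
have Bq0 : 0 <= B / (2 * q) by rewrite mulr_ge0 ?(ltW B0).
have c0 : 0 <= c.
  by rewrite addr_ge0// ?mulr_ge0 ?(ltW B0) ?(ltW sigma0) ?divr_ge0 ?(ltW q0).
have msum : measurable_fun setT
    (fun x : m.-tuple (borel X) => ((\sum_i f i (tnth x i)) ^+ 2)%:E).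
  apply/measurable_EFinP; apply: measurable_funX; apply: measurable_sum => i.
  by apply: (measurableT_comp (mf i)); exact: measurable_tnth.
rewrite ge0_integralD//; last 2 first.
- by move=> x _; rewrite -EFinM lee_fin mulr_ge0 ?sqr_ge0.
- exact: emeasurable_funM.
rewrite integral_cst//= probability_setT mule1 ge0_integralZl_EFin//; last first.
  by move=> x _; rewrite lee_fin sqr_ge0.
apply: (@le_trans _ _ (c%:E + (B / (2 * q))%:E * (q ^+ 2)%:E)%E).
  rewrite leeD2l// lee_wpmul2l// (le_trans (iid_second_moment fvar))//.
  by rewrite lee_fin sumr_const card_ord q2 -[leLHS]mulr_natl.
rewrite -EFinM -EFinD lee_fin le_eqVlt; apply/orP; left; apply/eqP.
by rewrite /c; field.
Qed.

(** A bound on the loss that is free of F, so that it passes through the supremum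
    over the class. *)
Definition total_error (w : m.-tuple (borel X) * m.-tuple (borel Y)) : \bar R :=
  (base%:E + \sum_j cell_error j w.1 w.2)%E.

Lemma measurable_total_error : measurable_fun setT total_error.
Proof.
apply: emeasurable_funD => //; apply: emeasurable_sum => j.
exact: measurable_cell_error.
Qed.

Lemma total_error_ge0 w : (0 <= total_error w)%E.
Proof.
by rewrite adde_ge0 ?lee_fin// sume_ge0// => j _; exact: cell_error_ge0.
Qed.

Lemma total_error_mean :
  (\int[iid nu m \x iid gamma m]_w total_error w <= level%:E)%E.
Proof.
have me j := measurable_cell_error j.
rewrite ge0_integralD//; last 2 first.
- by move=> w _; rewrite sume_ge0// => j _; exact: cell_error_ge0.
- by apply: emeasurable_sum => j.
rewrite ge0_integral_sum//; last by move=> j w _; exact: cell_error_ge0.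
rewrite [leRHS]EFinD leeD//.
  rewrite integral_cst// [X in (_ * X)%E](_ : _ = 1%E) ?mule1//.
  exact: probability_setT.
apply: (@le_trans _ _ (\sum_(j : J) ((B + sigma) * q)%:E)%E).
  apply: lee_sum => j _; rewrite fubini_tonelli1//.
    exact: cell_error_mean.
  by move=> w; exact: cell_error_ge0.
by rewrite sumEFin sumr_const lee_fin -[leLHS]mulr_natl.
Qed.

Lemma random_grid_risk :
  (random_design_risk mu gamma sigma p (lip_class B L) m <= level%:E)%E.
Proof.
apply: ge_ereal_inf; eexists; first by exists nu.
apply: ge_ereal_inf; eexists.
  by exists Fhat => //; exact: (grid_estimatorP mu m p1 sY g measurable_idx).
apply: ge_ereal_sup => _ [F FF <-]; apply: le_trans total_error_mean.
apply: ge0_le_integral_nonmeasurable => w; first exact: bochner_norm_ge0.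
exact: grid_loss_le.
Qed.

(** Some design is as good as the random one is on average, up to the factor 2. *)
Lemma fixed_grid_risk :
  (fixed_design_risk mu gamma sigma p (lip_class B L) m <= (2 * level)%:E)%E.
Proof.
have l0 : 0 < level.
  by apply: ltr_wpDl => //; apply: mulr_gt0 => //; apply: mulr_gt0 => //; exact: addr_gt0.
have [x xP] : exists x, (\int[iid gamma m]_eps total_error (x, eps) <= (2 * level)%:E)%E.
  apply: contrapT => no.
  have : ((2 * level)%:E <= \int[iid nu m]_x \int[iid gamma m]_eps total_error (x, eps))%E.
    apply: (@le_trans _ _ (\int[iid nu m]_x (2 * level)%:E)%E).
      by rewrite integral_cst//= probability_setT mule1.
    apply: ge0_le_integral_nonmeasurable => x; first by rewrite lee_fin mulr_ge0// ltW.
    by rewrite leNgt; apply/negP => /ltW xle; apply: no; exists x.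
  rewrite -(fubini_tonelli1 total_error measurable_total_error total_error_ge0).
  move=> /le_trans/(_ total_error_mean); rewrite lee_fin; apply/negP.
  by rewrite -ltNge ltr_pMl// ltr1n.
apply: ge_ereal_inf; eexists; first by exists x.
pose pair (y : m.-tuple (borel Y)) : m.-tuple (borel X * borel Y)%type :=
  [tuple (tnth x i, tnth y i) | i < m].
have mpair : measurable_fun setT pair.
  apply/measurable_fun_tnthP => i.
  rewrite (_ : _ \o _ = fun y => (tnth x i, tnth y i)).
    apply: measurable_fun_pair => //; exact: measurable_tnth.
  by apply/funext => y /=; rewrite tnth_mktuple.
have [Fspace Fmeas] := grid_estimatorP mu m p1 sY g measurable_idx.
apply: ge_ereal_inf; eexists.
  exists (Fhat \o pair) => //; split => [y|U oU]; first exact: Fspace.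
  by have := mpair measurableT _ (Fmeas U oU); rewrite setTI.
apply: ge_ereal_sup => _ [F FF <-]; apply: le_trans xP.
apply: ge0_le_integral_nonmeasurable => eps; first exact: bochner_norm_ge0.
exact: (grid_loss_le x eps FF).
Qed.

End grid_risk.

(** * The grid of a truncated eigenbasis *)

Lemma markov_integral d (T : measurableType d) (R : realType)
    (P : probability T R) (A : set T) (f : T -> \bar R) (c M : R) :
  measurable A -> 0 < c -> (forall x, 0 <= f x)%E ->
  (forall x, A x -> c%:E <= f x)%E -> (\int[P]_x f x <= M%:E)%E ->
  (P A <= (M / c)%:E)%E.
Proof.
move=> mA c0 f0 cf fM.
have : (c%:E * P A <= M%:E)%E.
  apply: le_trans fM.
  rewrite [leLHS](_ : _ = \int[P]_x (c * \1_A x)%:E)%E; last first.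
    rewrite (eq_integral (fun x => c%:E * (\1_A x)%:E)%E)//.
    rewrite ge0_integralZl_EFin//; last exact: ltW.
      by rewrite integral_indic// setIT.
    by apply/measurable_EFinP; exact: measurable_indic.
  apply: ge0_le_integral_nonmeasurable => x.
    by rewrite lee_fin mulr_ge0// ltW.
  rewrite indicE; case: (boolP (x \in A)) => [|_]; last by rewrite mulr0.
  by rewrite inE mulr1; exact: cf.
rewrite -[P A]fineK ?fin_num_measure// -EFinM !lee_fin => cPA.
by rewrite ler_pdivlMr// mulrC.
Qed.

Section eigen_grid.
Context {R : realType} {X : hilbertType R}.
Variables (mu : probability (borel X) R) (phi : nat -> X).
Variables (N k : nat) (rad eps : R).
Hypotheses (rad0 : 0 < rad) (eps0 : 0 < eps).
Hypothesis phi_orthonormal : forall i j, inner (phi i) (phi j) = (i == j)%:R.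
Hypothesis phi_spanning : spanning phi.
Local Notation cell := {ffun 'I_N -> 'I_k.+1}.
Local Notation step := (2 * rad / k.+1%:R).

(** Coordinates outside [-rad, rad) are sent to arbitrary cells; the points that
    have one belong to [off_grid]. *)
Definition grid_index (x : X) : cell :=
  [ffun i : 'I_N => inord (Num.truncn ((inner x (phi i) + rad) / step))].

Definition grid_point (j : cell) : X :=
  \sum_(i < N) (step * (j i)%:R - rad) *: phi i.

Definition off_grid : set (borel X) :=
  [set x | rad <= `|x : X|] `|` [set x | eps < `|(x : X) - span_proj phi N x|].

Let step0 : 0 < step. Proof. by rewrite divr_gt0// mulr_gt0. Qed.

Let phi_padded : padded_orthonormal phi.
Proof. by exists (fun=> true) => i j; rewrite andbT. Qed.

Let phi_unit i : `|phi i| = 1.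
Proof.
apply/eqP; rewrite -(@eqrXn2 _ 2)// expr1n -inner_norm phi_orthonormal eqxx.
by [].
Qed.

Lemma grid_point_inj : injective grid_point.
Proof.
move=> j l jl; apply/ffunP => i; apply/val_inj.
have coord (u : cell) : inner (grid_point u) (phi i) = step * (u i)%:R - rad.
  rewrite inner_suml (bigD1 i)//= big1 ?addr0 => [|i' ii'].
    by rewrite innerZl phi_orthonormal eqxx mulr1.
  by rewrite innerZl phi_orthonormal val_eqE (negbTE ii') mulr0.
have := coord l; rewrite -jl coord => /addIr/(mulfI (lt0r_neq0 step0))/eqP.
by rewrite eqr_nat => /eqP.
Qed.

Lemma measurable_truncn_fiber n :
  measurable ([set r : R | Num.truncn r = n]).
Proof.
rewrite (_ : [set r | _] = [set r | r < n.+1%:R] `&`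
    (if n is n'.+1 then [set r | n'.+1%:R <= r] else setT)).
  apply: measurableI.
    rewrite (_ : [set r | _] = `]-oo, n.+1%:R[%classic); first exact: measurable_itv.
    by apply/seteqP; split => r /=; rewrite in_itv.
  case: n => // n; rewrite (_ : [set r | _] = `[n.+1%:R, +oo[%classic).
    exact: measurable_itv.
  by apply/seteqP; split => r /=; rewrite in_itv/= andbT.
apply/seteqP; split => r /=.
  move=> <-; split; first by rewrite truncnS_gt.
  by case E : (Num.truncn r) => [//|n']; rewrite /= -truncn_gt_nat E.
rewrite -truncn_le_nat => -[rn]; case: n rn => [|n rn]; first by rewrite leqn0 => /eqP.
by rewrite /= -truncn_gt_nat => nr; apply/eqP; rewrite eqn_leq rn.
Qed.

Lemma measurable_grid_index j :
  measurable ([set x | grid_index x = j] : set (borel X)).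
Proof.
rewrite (_ : [set x | _] = \bigcap_(i in [set: 'I_N])
   ((fun x : borel X => (inner (x : X) (phi i) + rad) / step) @^-1`
     [set r | inord (Num.truncn r) = j i])).
  apply: fin_bigcap_measurable; first exact: finite_finset.
  move=> i _; rewrite -[X in measurable X]setTI.
  have mr : measurable_fun setT
      (fun x : borel X => (inner (x : X) (phi i) + rad) / step).
    apply: measurable_funM => //; apply: measurable_funD => //.
    exact: measurable_inner.
  apply: mr => //.
  rewrite (_ : [set r | _] = \bigcup_(n in [set n | inord n = j i])
      [set r : R | Num.truncn r = n]); last first.
    apply/seteqP; split => [r /= rj|r [n /= nj rn]]; last by rewrite rn.
    by exists (Num.truncn r).
  by apply: bigcup_measurable => n _; exact: measurable_truncn_fiber.
apply/seteqP; split => [x xj i _ /=|x xj /=].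
  by rewrite -xj ffunE.
by apply/ffunP => i; rewrite ffunE; exact: xj.
Qed.

Let measurable_residual : measurable_fun [set: borel X]
  (fun x : borel X => `|(x : X) - span_proj phi N x|).
Proof.
have cproj : continuous (fun x : X => x - span_proj phi N x).
  apply: (@lipschitz_continuous _ _ _ _ (1 + N%:R)) => x y.
  rewrite (opprD y) addrACA -opprD.
  apply: le_trans (ler_normB _ _) _; rewrite mulrDl mul1r lerD2l.
  rewrite /span_proj -sumrB (le_trans (ler_norm_sum _ _ _))//.
  apply: (@le_trans _ _ (\sum_(i < N) `|x - y|)); last first.
    by rewrite sumr_const card_ord mulr_natl.
  apply: ler_sum => i _; rewrite -scalerBl -innerBl normrZ phi_unit mulr1.
  by rewrite (le_trans (cauchy_schwarz _ _))// phi_unit mulr1.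
apply: (measurableT_comp measurable_borel_norm); exact: (continuous_borel cproj).
Qed.

Let measurable_far : measurable ([set x | rad <= `|x : X|] : set (borel X)).
Proof.
rewrite (_ : [set x | _] = (fun x : borel X => `|x : X|) @^-1` `[rad, +oo[%classic).
  rewrite -[X in measurable X]setTI.
  exact: (measurable_borel_norm measurableT (measurable_itv `[rad, +oo[)).
by apply/seteqP; split => x /=; rewrite in_itv/= andbT.
Qed.

Let measurable_rough :
  measurable ([set x | eps < `|(x : X) - span_proj phi N x|] : set (borel X)).
Proof.
rewrite (_ : [set x | _] =
    (fun x : borel X => `|(x : X) - span_proj phi N x|) @^-1` `]eps, +oo[%classic).
  rewrite -[X in measurable X]setTI.
  exact: (measurable_residual measurableT (measurable_itv `]eps, +oo[)).
by apply/seteqP; split => x /=; rewrite in_itv/= andbT.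
Qed.

Lemma measurable_off_grid : measurable off_grid.
Proof. exact: measurableU. Qed.

Lemma near_grid_point (x : borel X) : ~ off_grid x ->
  `|x - grid_point (grid_index x)| <= eps + N%:R * step.
Proof.
move=> xg.
have xrad : `|x : X| < rad by rewrite ltNge; apply/negP => h; apply: xg; left.
have xeps : `|(x : X) - span_proj phi N x| <= eps.
  by rewrite leNgt; apply/negP => h; apply: xg; right.
rewrite -(subrKA (span_proj phi N x)) (le_trans (ler_normD _ _))// lerD//.
rewrite /span_proj -sumrB (le_trans (ler_norm_sum _ _ _))//.
apply: (@le_trans _ _ (\sum_(i < N) step)); last first.
  by rewrite sumr_const card_ord -[leLHS]mulr_natl.
apply: ler_sum => i _; rewrite -scalerBl normrZ phi_unit mulr1 ffunE.
set y := (inner x (phi i) + rad) / step.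
have /andP[xi1 xi2] : - rad < inner x (phi i) < rad.
  rewrite -ltr_norml (le_lt_trans (cauchy_schwarz _ _))//.
  by rewrite phi_unit mulr1.
have y0 : 0 <= y by rewrite divr_ge0 ?(ltW step0)//; lra.
have yk : y < k.+1%:R.
  rewrite ltr_pdivrMr// mulrC divfK ?pnatr_eq0//; lra.
rewrite inordK; last first.
  by rewrite -(ltr_nat R) (le_lt_trans _ yk)// truncn_le.
have yE : inner x (phi i) = y * step - rad by rewrite divfK ?addrK// gt_eqF.
rewrite yE opprB addrA subrK mulrC -mulrBr normrM gtr0_norm//.
rewrite ler_piMr ?(ltW step0)// ger0_norm ?subr_ge0 ?truncn_le//.
by rewrite lerBlDl natr1 ltW// truncnS_gt.
Qed.

(** Markov's inequality for the second moments of X and of its residual. *)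
Lemma off_grid_mass (M T : R) :
  (\int[mu]_x (`|x : X| ^+ 2)%:E <= M%:E)%E ->
  (\sum_(i <oo) ((N <= i)%:R%:E * \int[mu]_x (inner (x : X) (phi i) ^+ 2)%:E)
     <= T%:E)%E ->
  (mu off_grid <= (M / rad ^+ 2 + T / eps ^+ 2)%:E)%E.
Proof.
move=> hM hT.
have far : (mu [set x | (rad <= `|x : X|)%R] <= (M / rad ^+ 2)%:E)%E.
  apply: (markov_integral (P := mu) (f := fun x : borel X => (`|x : X| ^+ 2)%:E)) => //.
  - by rewrite exprn_gt0.
  - by move=> x /= xr; rewrite lee_fin lerXn2r ?nnegrE// ltW.
have mi i : measurable_fun setT (fun x : borel X => inner (x : X) (phi i) ^+ 2).
  by apply: measurable_funX; exact: measurable_inner.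
have rough : (mu [set x | (eps < `|(x : X) - span_proj phi N x|)%R] <=
    (T / eps ^+ 2)%:E)%E.
  apply: (markov_integral (P := mu)
    (f := fun x : borel X => \sum_(i <oo) ((N <= i)%:R * inner (x : X) (phi i) ^+ 2)%:E)%E) => //.
  - by rewrite exprn_gt0.
  - by move=> x; apply: nneseries_ge0 => i _ _; rewrite lee_fin mulr_ge0 ?sqr_ge0.
  - move=> x /= xe; apply: le_trans (residual_le N x phi_padded phi_spanning).
    by rewrite lee_fin lerXn2r ?nnegrE// ltW// (lt_trans eps0).
  rewrite integral_nneseries//; last 2 first.
  - by move=> i; apply/measurable_EFinP; apply: measurable_funM.
  - by move=> i x _; rewrite lee_fin mulr_ge0 ?sqr_ge0.
  apply: le_trans hT; rewrite le_eqVlt; apply/orP; left; apply/eqP.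
  apply: eq_eseriesr => i _.
  rewrite (eq_integral (fun x : borel X => (N <= i)%:R%:E * (inner (x : X) (phi i) ^+ 2)%:E)%E)//.
  rewrite ge0_integralZl_EFin//; last exact/measurable_EFinP.
  by move=> x _; rewrite lee_fin sqr_ge0.
rewrite EFinD; apply: le_trans (leeD far rough).
exact: (measureU2 mu measurable_far measurable_rough).
Qed.

End eigen_grid.

(** * Both risks at exponential eigenvalues *)

Section risk_upper_bound.
Context {R : realType}.

Lemma nneseries_geometric_le (q : R) : 0 <= q < 1 ->
  (\sum_(i <oo) (q ^+ i)%:E <= ((1 - q)^-1)%:E)%E.
Proof.
move=> /andP[q0 q1]; apply: lime_le.
  by apply: is_cvg_nneseries => i _ _; rewrite lee_fin exprn_ge0.
apply: nearW => n; rewrite sumEFin lee_fin big_mkord.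
rewrite -[leRHS]mul1r ler_pdivlMr ?subr_gt0//.
have := subrX1 q n; move: (\sum_(i < n) q ^+ i) => S qS.
have := exprn_ge0 n q0; nra.
Qed.

(** Half of the exponent gives the factor exp (- tau / 2 N ^ omega), the other
    half a geometric series because (i + 1) ^ omega >= i + 1. *)
Lemma eigenvalue_tail (tau omega : R) (N : nat) : 0 < tau -> 1 <= omega ->
  (\sum_(i <oo) ((N <= i)%:R * expR (- (tau * i.+1%:R `^ omega)))%:E <=
   (expR (- (tau / 2 * N%:R `^ omega)) / (1 - expR (- (tau / 2))))%:E)%E.
Proof.
move=> tau0 omega1; set q := expR (- (tau / 2)).
have q1 : q < 1 by rewrite expR_lt1; lra.
have q0 : 0 < q by exact: expR_gt0.
rewrite EFinM; apply: (@le_trans _ _ ((expR (- (tau / 2 * N%:R `^ omega)))%:E *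
    \sum_(i <oo) (q ^+ i)%:E)%E); last first.
  by rewrite lee_wpmul2l ?lee_fin ?expR_ge0// nneseries_geometric_le// q1 ltW.
rewrite -nneseriesZl => [|i _]; last by rewrite lee_fin exprn_ge0// ltW.
apply: lee_nneseries => [i _ _|i _].
  by rewrite lee_fin mulr_ge0// expR_ge0.
rewrite -EFinM lee_fin; case: leqP => [Ni|_]; last first.
  by rewrite mul0r mulr_ge0 ?expR_ge0// exprn_ge0// ltW.
rewrite mul1r /q -expRM_natl -expRD ler_expR.
have h1 : i.+1%:R <= i.+1%:R `^ omega :> R by rewrite le1r_powR// ler1n.
have h2 : N%:R `^ omega <= i.+1%:R `^ omega :> R.
  by rewrite ge0_ler_powR ?nnegrE ?ler0n// ?ler_nat ?(leqW Ni)//; lra.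
have h3 : i%:R + 1 = i.+1%:R :> R by rewrite natr1.
have t2 : 0 <= tau / 2 by lra.
have := ler_wpM2l t2 h1; have := ler_wpM2l t2 h2.
move: (i.+1%:R `^ omega) (N%:R `^ omega) => P Q; rewrite -h3; lra.
Qed.

Context {X Y : hilbertType R}.
Variables (mu : probability (borel X) R) (gamma : probability (borel Y) R).
Variables (p B L sigma tau omega : R) (lam : nat -> R) (phi : nat -> X).
Hypotheses (p1 : 1 <= p) (sY : separable Y) (B0 : 0 < B) (L0 : 0 < L).
Hypotheses (sigma0 : 0 < sigma) (tau0 : 0 < tau) (omega1 : 1 <= omega).
Hypotheses (mu_i : cond_i mu) (mu_ii : cond_ii mu lam phi).
Hypothesis lamE : forall i, lam i = expR (- (tau * i.+1%:R `^ omega)).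
Hypothesis gamma_noise : gaussian_noise gamma.

(** A grid of radius 1 / u with k + 1 points per dimension, where truncation to N
    coordinates is allowed to move a point by u. *)
Lemma risk_upper_bound (S : R) (u : R) (N k m : nat) (M : nat -> \bar R) :
  0 < u -> (0 < m)%N ->
  (\int[mu]_x (`|x : X| ^+ 2)%:E <= S%:E)%E ->
  M = fixed_design_risk mu gamma sigma p (lip_class B L) \/
  M = random_design_risk mu gamma sigma p (lip_class B L) ->
  (M m <= (2 * (L * (u + N%:R * (2 * u^-1 / k.+1%:R)) +
     2 * B * (S / u^-1 ^+ 2 + expR (- (tau / 2 * N%:R `^ omega)) /
       (1 - expR (- (tau / 2))) / u ^+ 2) `^ p^-1 +
     (k.+1 ^ N)%:R * ((B + sigma) * ((k.+1 ^ N)%:R / Num.sqrt m%:R))))%:E)%E.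
Proof.
move=> u0 m0 hS HM; have [mean0 _] := mu_i.
have [_ [phio phis] [C [covC Cphi]] _] := mu_ii.
have u0' : 0 < u^-1 by rewrite invr_gt0.
pose J : finType := {ffun 'I_N -> 'I_k.+1}.
have cardJ : #|J| = (k.+1 ^ N)%N by rewrite card_ffun !card_ord.
have J0 : (0 < #|J|)%N by rewrite cardJ expn_gt0.
pose idx := grid_index phi N k u^-1.
pose g := @grid_point _ _ phi N k u^-1.
have g_inj : injective g by exact: grid_point_inj.
have [nu nuP] := @uniform_measure_on R _ (borel X) J g g_inj J0.
have [e [v noise]] := gaussian_noise_coordinates sY gamma_noise.
have massP : (mu (off_grid phi N u^-1 u) <= (S / u^-1 ^+ 2 +
    expR (- (tau / 2 * N%:R `^ omega)) / (1 - expR (- (tau / 2))) / u ^+ 2)%:E)%E.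
  apply: off_grid_mass => //.
  apply: le_trans (eigenvalue_tail N tau0 omega1).
  rewrite le_eqVlt; apply/orP; left; apply/eqP; apply: eq_eseriesr => i _.
  rewrite (inner_second_moment _ mean0 covC) Cphi innerZl phio eqxx mulr1 lamE.
  by [].
have massp : (mu (off_grid phi N u^-1 u) `^ p^-1 <= ((S / u^-1 ^+ 2 +
    expR (- (tau / 2 * N%:R `^ omega)) / (1 - expR (- (tau / 2))) / u ^+ 2)
      `^ p^-1)%:E)%E.
  rewrite -poweR_EFin; apply: gt0_ler_poweR => //.
  - by rewrite invr_ge0 (le_trans _ p1).
  - by rewrite in_itv/= leey andbT measure_ge0.
  - by rewrite in_itv/= leey andbT (le_trans _ massP)// measure_ge0.
have c10 : 0 <= u + N%:R * (2 * u^-1 / k.+1%:R).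
  by rewrite addr_ge0 ?(ltW u0)// mulr_ge0// divr_ge0// mulr_ge0// ltW.
have midx j : measurable ([set x | idx x = j] : set (borel X)).
  exact: measurable_grid_index.
have mbad : measurable (off_grid phi N u^-1 u) by exact: measurable_off_grid.
have near x : ~ off_grid phi N u^-1 u x ->
    `|x - g (idx x)| <= u + N%:R * (2 * u^-1 / k.+1%:R).
  by move=> xb; exact: near_grid_point.
have := fixed_grid_risk p1 sY B0 L0 sigma0 m0 midx J0 mbad c10 near massp noise nuP.
have := random_grid_risk p1 sY B0 L0 sigma0 m0 midx J0 mbad c10 near massp noise nuP.
rewrite -!cardJ => rnd fix_; case: HM => ->; first exact: fix_.
apply: (le_trans rnd); rewrite lee_fin ler_peMl ?ler1n//.
rewrite addr_ge0//; last first.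
  by rewrite mulr_ge0// mulr_ge0 ?divr_ge0// addr_ge0// ltW.
by rewrite addr_ge0// !mulr_ge0 ?powR_ge0// ltW.
Qed.

End risk_upper_bound.

(** * Asymptotics of the two bounds *)

Section real_asymptotics.
Context {R : realType}.
Implicit Types (t s x : R).

Lemma sqr_le_expR x : 0 <= x -> x ^+ 2 / 4 <= expR x.
Proof.
move=> x0; have h := expR_ge1Dx (x / 2).
have -> : expR x = expR (x / 2) ^+ 2 by rewrite expr2 -expRD; congr expR; lra.
have h2 : x / 2 <= expR (x / 2) by lra.
by have := ler_pM (y1 := expR (x/2)) _ _ h2 h2; rewrite expr2; nra.
Qed.

Lemma log_sample_size (sigma T : R) : 0 < sigma ->
  \forall m \near \oo, T <= ln (m%:R / sigma ^+ 2).
Proof.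
move=> sigma0; have s2 : 0 < sigma ^+ 2 by rewrite exprn_gt0.
near=> m.
have mT : expR T * sigma ^+ 2 <= m%:R by near: m; exact: nbhs_infty_ger.
rewrite -ler_expR lnK ?ler_pdivlMr// posrE divr_gt0//.
by apply: lt_le_trans mT; rewrite mulr_gt0// expR_gt0.
Unshelve. all: by end_near. Qed.

(** With l = log (m / sigma ^ 2), the truncation dimension is of order
    t = l ^ (1 / (omega + 1)) and the rate is s = t ^ omega, so that l = t s:
    the eigenvalue of index t and the resolution of a grid of m points in
    dimension t are both exp (- s) up to a constant in the exponent. *)
Lemma log_scales (omega l : R) : 1 <= omega -> 0 < l ->
  let t := l `^ (omega + 1)^-1 in
  l `^ (omega / (omega + 1)) = t `^ omega /\ l = t * t `^ omega.
Proof.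
move=> omega1 l0 t; have o1 : omega + 1 != 0 by rewrite gt_eqF//; lra.
have tw : l `^ (omega / (omega + 1)) = t `^ omega by rewrite -powRrM mulrC.
split => //; rewrite -tw -powRD; last first.
  by apply/implyP => _; rewrite gt_eqF.
have -> : (omega + 1)^-1 + omega / (omega + 1) = 1 by field.
by rewrite powRr1// ltW.
Qed.

Lemma scale_ge (omega l T : R) : 1 <= omega -> 1 <= T -> T `^ (omega + 1) <= l ->
  T <= l `^ (omega + 1)^-1.
Proof.
move=> omega1 T1 Tl; have o1 : omega + 1 != 0 by rewrite gt_eqF//; lra.
have -> : T = (T `^ (omega + 1)) `^ (omega + 1)^-1.
  by rewrite -powRrM mulfV// powRr1//; lra.
by rewrite ge0_ler_powR ?nnegrE ?powR_ge0 ?invr_ge0 ?(le_trans (powR_ge0 _ _) Tl)//; lra.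
Qed.

Lemma lne_ge (M : \bar R) y : (M <= (expR (- y))%:E)%E -> (y%:E <= - lne M)%E.
Proof.
case: M => [r| |]//=; rewrite ?leey// lee_fin => ry.
case: (leP r 0) => r0; first by rewrite leey.
rewrite -EFinN lee_fin lerNr -ler_expR lnK//.
Qed.

Lemma lne_le (M : \bar R) y : ((expR (- y))%:E <= M)%E -> (- lne M <= y%:E)%E.
Proof.
case: M => [r| |]//=; rewrite ?leNye// lee_fin => ry.
have r0 : 0 < r by exact: lt_le_trans (expR_gt0 _) ry.
rewrite (lt_geF r0) -EFinN lee_fin lerNl -ler_expR lnK//.
Qed.

Lemma linear_le_expR (A kap t s : R) : 0 < kap -> 0 <= t -> t <= s ->
  4 * A / kap ^+ 2 <= t -> A * t <= expR (kap * s).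
Proof.
move=> kap0 t0 ts; rewrite ler_pdivrMr ?exprn_gt0// => At.
have kt0 : 0 <= kap * t by rewrite mulr_ge0// ltW.
apply: (@le_trans _ _ (expR (kap * t))); last by rewrite ler_expR ler_pM2l.
apply: le_trans (sqr_le_expR kt0); rewrite exprMn.
by have := ler_wpM2r t0 At; move: (kap ^+ 2) => K; rewrite expr2; lra.
Qed.

(** A grid with about exp (2 delta s) points per dimension, in about t
    dimensions, is small compared with sqrt m = sigma exp (t s / 2). *)
Lemma grid_size_le (sigma delta t s K m : R) (N : nat) :
  0 < sigma -> 0 < delta -> 40 * delta <= 1 -> 80 <= t -> t <= s ->
  N%:R <= 2 * t -> 0 < m -> ln (m / sigma ^+ 2) = t * s ->
  0 <= K <= 2 * expR (delta * s) ^+ 2 ->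
  K ^+ N * (K ^+ N / Num.sqrt m) <= expR (- (delta * s)) / sigma.
Proof.
move=> sigma0 delta0 d40 t80 ts N2 m0 lE /andP[K0 K2].
have ds0 : 0 <= delta * s by rewrite mulr_ge0 ?(ltW delta0)//; lra.
have sqm : Num.sqrt m = sigma * expR (t * s / 2).
  rewrite -[RHS]ger0_norm ?mulr_ge0 ?expR_ge0 ?(ltW sigma0)// -sqrtr_sqr.
  congr Num.sqrt; rewrite exprMn.
  have -> : expR (t * s / 2) ^+ 2 = expR (t * s).
    by rewrite -expRM_natl mulrC divfK.
  rewrite -lE lnK ?posrE; first by rewrite mulrC divfK// expf_neq0// gt_eqF.
  by rewrite divr_gt0// exprn_gt0.
set E := expR (2 * t * (1 + 2 * (delta * s))).
have Ku : K ^+ N <= E.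
  apply: (@le_trans _ _ (expR (1 + 2 * (delta * s)) ^+ N)).
    rewrite lerXn2r ?nnegrE ?expR_ge0//.
    apply: (le_trans K2); rewrite expRD ler_pM ?sqr_ge0//.
      by apply: le_trans (expR_ge1Dx 1).
    by rewrite -expRM_natl.
  rewrite -expRM_natl ler_expR ler_wpM2r//.
  by rewrite addr_ge0// mulr_ge0.
have KN0 : 0 <= K ^+ N by rewrite exprn_ge0.
rewrite mulrA sqm ler_pdivrMr ?mulr_gt0 ?expR_gt0//.
rewrite mulrA divfK ?gt_eqF// -expRD.
apply: (@le_trans _ _ (E * E)); first by rewrite ler_pM.
rewrite -expRD ler_expR.
have h1 : 80 * t <= t * s.
  by rewrite mulrC ler_wpM2l ?(le_trans _ t80) ?(le_trans t80).
have h2 : 40 * delta * (t * s) <= 1 * (t * s) by rewrite ler_wpM2r// mulr_ge0//; lra.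
have h3 : 1 * (delta * s) <= t * (delta * s) by rewrite ler_wpM2r//; lra.
clear - h1 h2 h3 t80.
have e1 : 2 * t * (1 + 2 * (delta * s)) = 2 * t + 4 * delta * (t * s) by ring.
have e2 : t * (delta * s) = delta * (t * s) by ring.
rewrite e1; rewrite e2 in h3; move: h1 h2 h3.
move: (t * s) (delta * s) => P Q; lra.
Qed.

Definition truncation_dim (t : R) := (Num.truncn t).+1.

End real_asymptotics.

Section exponential_bounds.
Context {R : realType}.
Variables (tau omega p : R).
Hypotheses (tau0 : 0 < tau) (omega1 : 1 <= omega) (p1 : 1 <= p).

Let scale_le (t : R) : 1 <= t -> t <= t `^ omega.
Proof. by move=> t1; rewrite le1r_powR. Qed.

Let dimP (t : R) : 1 <= t -> t < (truncation_dim t)%:R <= 2 * t.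
Proof.
move=> t1; rewrite truncnS_gt/= /truncation_dim -[leLHS]natr1.
have : (Num.truncn t)%:R <= t by rewrite truncn_le; lra.
lra.
Qed.

Let dim_pow (t : R) : 1 <= t ->
  t `^ omega <= (truncation_dim t)%:R `^ omega <= 2 `^ omega * t `^ omega.
Proof.
move=> t1; have /andP[h1 h2] := dimP t1.
have w0 : 0 <= omega by apply: le_trans omega1.
have t0 : 0 <= t by apply: le_trans t1.
apply/andP; split.
  by rewrite ge0_ler_powR ?nnegrE// ltW.
by rewrite -powRM// ge0_ler_powR ?nnegrE// mulr_ge0.
Qed.

(** In the exponent, k contributes 2 s because k is about (2 m) ^ (1 / N), the
    smallest eigenvalue contributes tau / 2 * 2 ^ omega * s because N <= 2 t,
    the mass of the cores 2 |ln (iota / 2)| s, and the remaining s absorbs the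
    constants, which depend on all the data. *)
Lemma lower_asymptotics (B L a b sigma iota : R) :
  0 < B -> 0 < L -> 0 < a -> 0 < b -> 0 < sigma -> iota = 2 * a * b ->
  exists2 T : R, 1 <= T & forall (t : R) (m : nat), T <= t -> (0 < m)%N ->
    ln (m%:R / sigma ^+ 2) = t * t `^ omega ->
    exists k N eta Lam, [/\ (0 < k)%N, (2 * m <= k ^ N)%N, 0 < eta, 0 < Lam &
     [/\ forall i, (i < N)%N -> Lam <= Num.sqrt (expR (- (tau * i.+1%:R `^ omega))),
      eta * (a / k%:R) <= B, eta <= L / 2 * Lam &
      expR (- ((3 + tau / 2 * 2 `^ omega + 2 * `|ln (iota / 2)|) * t `^ omega)) <=
        eta * (a / k%:R / 2) * ((a * b) ^+ N / 2) `^ p^-1]].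
Proof.
move=> B0 L0 a0 b0 sigma0 iotaE.
have s2 : 0 < sigma ^+ 2 by rewrite exprn_gt0.
have ab0 : 0 < a * b by rewrite mulr_gt0.
have abE : a * b = iota / 2 by rewrite iotaE; lra.
pose c0 := Num.min (B / a) (L / 2).
have c00 : 0 < c0 by rewrite lt_min !divr_gt0.
pose K1 := ln (2 * sigma ^+ 2).
pose K2 := - ln c0 - ln a + 3 * ln 2.
(* K1 is the gap between log (2 m) and t s, and K2 collects the constants in
   the logarithm of the bound. *)
exists (1 + `|K1| + `|K2|) => [|t m tT m0 lE].
  by rewrite -addrA lerDl addr_ge0.
have t1 : 1 <= t by apply: le_trans tT; rewrite -addrA lerDl addr_ge0.
have /andP[N1 N2] := dimP t1; have /andP[_ D2] := dim_pow t1.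
have ts := scale_le t1.
set N := truncation_dim t in N1 N2 D2 *; set s := t `^ omega in lE D2 ts *.
have N0 : 0 < N%:R :> R by rewrite ltr0n.
have mR : 0 < m%:R :> R by rewrite ltr0n.
pose z : R := ln (2 * m%:R) / N%:R.
pose k := (Num.truncn (expR z)).+1.
have k0 : 0 < k%:R :> R by rewrite ltr0n.
have kz : expR z < k%:R by rewrite truncnS_gt.
have lnm : ln (2 * m%:R) = t * s + K1.
  rewrite -lE /K1 -lnM ?posrE ?divr_gt0 ?mulr_gt0//; congr ln.
  by rewrite mulrCA divfK// gt_eqF.
have z2 : z <= 2 * s.
  rewrite ler_pdivrMr// lnm.
  have hK1 : K1 <= t.
    by apply: le_trans (ler_norm _) _; have := normr_ge0 K2; lra.
  have s0 : 0 <= s by lra.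
  have h : t * s <= N%:R * s by rewrite ler_wpM2r// ltW.
  have h' : t <= N%:R * s by rewrite (le_trans ts)// ler_peMl ?ler1n//; lra.
  by rewrite -mulrA (mulrC s); lra.
have z0 : 0 <= z.
  rewrite divr_ge0// ln_ge0//.
  have : 1 <= m%:R :> R by rewrite ler1n.
  by move: (m%:R : R) => x; lra.
have k2 : k%:R <= 2 * expR z.
  have h : 1 <= expR z by apply: le_trans (expR_ge1Dx z); rewrite lerDl.
  have h' : (Num.truncn (expR z))%:R <= expR z by rewrite truncn_le expR_ge0.
  by rewrite /k -[leLHS]natr1; lra.
pose Lam := expR (- (tau / 2 * N%:R `^ omega)).
pose eta := c0 * Lam.
have Lam0 : 0 < Lam by exact: expR_gt0.
have Lam1 : Lam <= 1.
  by rewrite expR_le1 oppr_le0 mulr_ge0 ?powR_ge0// divr_ge0// ltW.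
have k1 : 1 <= k%:R :> R by rewrite ler1n.
have ak0 : 0 < a / k%:R by rewrite divr_gt0.
exists k, N, eta, Lam; split => //.
- rewrite -(ler_nat R) natrM natrX.
  apply: (@le_trans _ _ (expR z ^+ N)); last by rewrite lerXn2r ?nnegrE ?expR_ge0// ltW.
  by rewrite -expRM_natr /z divfK ?gt_eqF// lnK// posrE mulr_gt0.
- by rewrite mulr_gt0.
split.
- move=> i iN; rewrite -[leLHS]ger0_norm ?(ltW Lam0)// -sqrtr_sqr ler_wsqrtr//.
  rewrite expr2 -expRD ler_expR.
  have : i.+1%:R `^ omega <= N%:R `^ omega :> R.
    by rewrite ge0_ler_powR ?nnegrE ?ler0n ?ler_nat// (le_trans ler01 omega1).
  by move=> /(ler_wpM2l (ltW tau0)); lra.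
- apply: (@le_trans _ _ ((B / a) * a)); last by rewrite divfK// gt_eqF.
  have c0B : c0 <= B / a by rewrite ge_min lexx.
  have etaB : eta <= B / a by apply: le_trans c0B; rewrite ler_piMr// ltW.
  have aka : a / k%:R <= a by rewrite ler_pdivrMr// ler_peMr// ltW.
  by apply: ler_pM => //; [exact: (mulr_ge0 (ltW c00) (ltW Lam0))|exact: (ltW ak0)].
- by rewrite ler_wpM2r ?(ltW Lam0)// ge_min lexx orbT.
have p0 : 0 < p := lt_le_trans ltr01 p1.
have q0 : 0 < p^-1 by rewrite invr_gt0.
have q1 : p^-1 <= 1 by rewrite invf_le1.
have abN0 : 0 < (a * b) ^+ N by rewrite exprn_gt0.
set li := ln (iota / 2).
have eta0 : 0 < eta by rewrite mulr_gt0.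
have ak20 : 0 < a / k%:R / 2 by rewrite divr_gt0.
have ab20 : 0 < (a * b) ^+ N / 2 by rewrite divr_gt0.
have mass0 : 0 < ((a * b) ^+ N / 2) `^ p^-1 by rewrite powR_gt0.
rewrite -[leRHS]lnK ?ler_expR; last first.
  by rewrite posrE (mulr_gt0 (mulr_gt0 eta0 ak20) mass0).
rewrite (lnM (mulr_gt0 eta0 ak20) mass0) (lnM eta0 ak20) (lnM c00 Lam0).
rewrite expRK ln_div ?posrE// ln_div ?posrE// ln_powR ln_div ?posrE// lnXn// abE -/li.
have lnk : ln k%:R <= ln 2 + z.
  by rewrite -[X in _ + X]expRK -lnM ?posrE ?expR_gt0// ler_ln ?posrE ?mulr_gt0 ?expR_gt0.
have ln20 : 0 <= ln 2 :> R by rewrite ln_ge0// ler1n.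
set w := li *+ N.
have wN : - (2 * `|li| * s) <= w.
  have -> : w = li * N%:R by rewrite /w mulr_natr.
  have h0 : - `|li| <= li by rewrite lerNl -normrN ler_norm.
  have h1 : - `|li| * N%:R <= li * N%:R by rewrite ler_wpM2r.
  have h2 : `|li| * N%:R <= `|li| * (2 * s) by rewrite ler_wpM2l//; lra.
  by move: h1 h2; lra.
have hw : - (2 * `|li| * s) - ln 2 <= p^-1 * (w - ln 2).
  have h0 : 0 <= 2 * `|li| * s by rewrite !mulr_ge0//; lra.
  have : p^-1 * (- (2 * `|li| * s) - ln 2) <= p^-1 * (w - ln 2).
    by rewrite ler_wpM2l ?(ltW q0)//; lra.
  have : p^-1 * (2 * `|li| * s + ln 2) <= 1 * (2 * `|li| * s + ln 2).
    by rewrite ler_wpM2r//; lra.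
  by lra.
have hD : tau / 2 * N%:R `^ omega <= tau / 2 * (2 `^ omega * s).
  by rewrite ler_wpM2l// divr_ge0// ltW.
have hK2 : K2 <= s.
  by apply: le_trans (ler_norm _) _; have := normr_ge0 K1; lra.
move: hK2; rewrite /K2 => hK2.
by move: hw hD lnk z2; move: (p^-1 * _) (ln k%:R) (N%:R `^ omega) => *; lra.
Qed.

(** The bound is evaluated at u = exp (- delta s), with about u ^ -2 grid points
    per dimension. The condition delta <= tau / 6 makes the eigenvalue tail at
    most u ^ 3, which survives the division by u ^ 2 in Markov's inequality;
    delta <= 1 / 40 keeps the grid small compared with m. The power 1 / p of the
    probability of the bad set dominates, and half of its exponent is given up
    to absorb the constants and the factor t. *)
Lemma upper_asymptotics (B L sigma S : R) :
  0 < B -> 0 < L -> 0 < sigma -> 0 <= S ->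
  let delta := Num.min (tau / 6) 40^-1 in
  exists2 T : R, 1 <= T & forall (t : R) (m : nat), T <= t -> (0 < m)%N ->
    ln (m%:R / sigma ^+ 2) = t * t `^ omega ->
    exists u N k, 0 < u /\
     2 * (L * (u + N%:R * (2 * u^-1 / k.+1%:R)) +
     2 * B * (S / u^-1 ^+ 2 + expR (- (tau / 2 * N%:R `^ omega)) /
       (1 - expR (- (tau / 2))) / u ^+ 2) `^ p^-1 +
     (k.+1 ^ N)%:R * ((B + sigma) * ((k.+1 ^ N)%:R / Num.sqrt m%:R))) <=
     expR (- (delta / (2 * p) * t `^ omega)).
Proof.
move=> B0 L0 sigma0 S0 delta.
have delta0 : 0 < delta by rewrite lt_min divr_gt0//= invr_gt0.
have dtau : 6 * delta <= tau.
  have : delta <= tau / 6 by rewrite ge_min lexx.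
  lra.
have d40 : 40 * delta <= 1.
  have : delta <= 40^-1 by rewrite ge_min lexx orbT.
  lra.
have s2 : 0 < sigma ^+ 2 by rewrite exprn_gt0.
have p0 : 0 < p := lt_le_trans ltr01 p1.
have q0 : 0 < p^-1 by rewrite invr_gt0.
have q1 : p^-1 <= 1 by rewrite invf_le1.
pose C := (1 - expR (- (tau / 2)))^-1.
have C0 : 0 < C by rewrite invr_gt0 subr_gt0 expR_lt1 oppr_lt0 divr_gt0.
pose A1 := 2 * B * (S + C) `^ p^-1.
pose A2 := (B + sigma) / sigma.
pose A := 2 * (6 * L + A1 + A2).
have A10 : 0 <= A1 by rewrite !mulr_ge0 ?powR_ge0// ltW.
have A20 : 0 <= A2 by rewrite divr_ge0 ?addr_ge0// ltW.
have A0 : 0 <= A by rewrite mulr_ge0//; lra.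
pose kap := delta / (2 * p).
have kap0 : 0 < kap by rewrite divr_gt0// mulr_gt0.
(* 80 <= t makes the grid term negligible, and 4 A / kap ^ 2 <= t gives
   A t <= exp (kap s) because exp x >= x ^ 2 / 4. *)
exists (80 + 4 * A / kap ^+ 2) => [|t m tT m0 lE].
  have : 0 <= 4 * A / kap ^+ 2 by rewrite divr_ge0 ?sqr_ge0// mulr_ge0.
  lra.
have hAk : 4 * A / kap ^+ 2 <= t by lra.
have t80 : 80 <= t.
  have : 0 <= 4 * A / kap ^+ 2 by rewrite divr_ge0 ?sqr_ge0// mulr_ge0.
  lra.
have t1 : 1 <= t by lra.
have /andP[N1 N2] := dimP t1; have /andP[D1 _] := dim_pow t1.
have ts := scale_le t1.
set N := truncation_dim t in N1 N2 D1; set s := t `^ omega in lE D1 ts *.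
have mR : 0 < m%:R :> R by rewrite ltr0n.
pose u := expR (- (delta * s)).
have u0 : 0 < u by exact: expR_gt0.
have ds0 : 0 <= delta * s by rewrite mulr_ge0 ?(ltW delta0)//; lra.
have u1 : u <= 1 by rewrite expR_le1 oppr_le0.
pose k := Num.truncn (u^-1 ^+ 2).
have ui0 : 0 < u^-1 by rewrite invr_gt0.
have ui1 : 1 <= u^-1 by rewrite invf_ge1.
have ui2 : 1 <= u^-1 ^+ 2 by rewrite exprn_ege1.
have k0 : 0 < k.+1%:R :> R by rewrite ltr0n.
have kl : u^-1 ^+ 2 < k.+1%:R by rewrite truncnS_gt.
have ku : k.+1%:R <= 2 * u^-1 ^+ 2.
  have h : k%:R <= u^-1 ^+ 2 by rewrite truncn_le; lra.
  by rewrite -[leLHS]natr1; lra.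
exists u, N, k; split => //.
pose v := u `^ p^-1.
have v0 : 0 <= v by exact: powR_ge0.
have uv : u <= v by rewrite ger1_powR// u0.
have term1 : u + N%:R * (2 * u^-1 / k.+1%:R) <= 6 * t * u.
  have h : 2 * u^-1 / k.+1%:R <= 2 * u.
    rewrite ler_pdivrMr// -mulrA ler_wpM2l//.
    have -> : u^-1 = u * u^-1 ^+ 2 by rewrite expr2 mulrA divff ?mul1r// gt_eqF.
    by rewrite ler_pM2l// ltW.
  have h2 : N%:R * (2 * u^-1 / k.+1%:R) <= (2 * t) * (2 * u).
    by rewrite ler_pM// divr_ge0// mulr_ge0// ltW.
  have h3 : 1 * u <= t * u by rewrite ler_wpM2r// ltW.
  by move: h2 h3; move: (N%:R * _) => W; lra.
have term2 : (S / u^-1 ^+ 2 + expR (- (tau / 2 * N%:R `^ omega)) /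
       (1 - expR (- (tau / 2))) / u ^+ 2) `^ p^-1 <= (S + C) `^ p^-1 * v.
  have SC : 0 <= S + C by rewrite addr_ge0// ltW.
  have E3 : expR (- (tau / 2 * N%:R `^ omega)) <= u ^+ 3.
    rewrite -expRM_natl ler_expR.
    have := ler_wpM2l (ltW tau0) D1.
    have : (6 * delta) * s <= tau * s by rewrite ler_wpM2r//; lra.
    by lra.
  rewrite -powRM// ?(ltW u0)// ge0_ler_powR ?(ltW q0) ?nnegrE//.
  - rewrite addr_ge0// divr_ge0 ?sqr_ge0//.
    by rewrite mulr_ge0 ?expR_ge0// (ltW C0).
  - by rewrite mulr_ge0// ltW.
  rewrite mulrDl lerD//.
    by rewrite exprVn invrK ler_wpM2l// expr2 ler_piMr// (ltW u0).
  rewrite ler_pdivrMr ?exprn_gt0// -/C [leLHS]mulrC -[leRHS]mulrA.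
  by rewrite ler_wpM2l ?(ltW C0)// -exprS.
have term3 : (k.+1 ^ N)%:R * ((k.+1 ^ N)%:R / Num.sqrt m%:R) <= u / sigma.
  have kb : 0 <= (k.+1%:R : R) <= 2 * expR (delta * s) ^+ 2.
    rewrite (ltW k0)/=; move: ku.
    by have -> : u^-1 = expR (delta * s) by rewrite /u expRN invrK.
  rewrite natrX; exact: (grid_size_le sigma0 delta0 d40 t80 ts N2 mR lE kb).
have tv : v <= t * v by rewrite ler_peMl.
have final : A * (t * v) <= expR (- (kap * s)).
  have -> : expR (- (kap * s)) = expR (kap * s) * v.
    rewrite /v /u -expRM -expRD; congr expR.
    by rewrite /kap; field; rewrite gt_eqF.
  have t0 : 0 <= t := le_trans ler01 t1.
  by rewrite mulrA ler_wpM2r// (linear_le_expR kap0 t0 ts hAk).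
apply: le_trans final.
have h1 := ler_wpM2l (ltW L0) term1.
have h2 : 2 * B * (S / u^-1 ^+ 2 + expR (- (tau / 2 * N%:R `^ omega)) /
       (1 - expR (- (tau / 2))) / u ^+ 2) `^ p^-1 <= A1 * v.
  by rewrite /A1 -[leRHS]mulrA ler_wpM2l// mulr_ge0// ltW.
have h3 : (k.+1 ^ N)%:R * ((B + sigma) * ((k.+1 ^ N)%:R / Num.sqrt m%:R)) <= A2 * u.
  have Bs0 : 0 <= B + sigma by rewrite addr_ge0 ?(ltW B0) ?(ltW sigma0).
  rewrite mulrCA [leRHS](_ : _ = (B + sigma) * (u / sigma)); first exact: ler_wpM2l.
  by rewrite /A2 mulrAC mulrA.
have h4 : L * (6 * t * u) <= 6 * L * (t * v).
  rewrite [leLHS](_ : _ = 6 * L * (t * u)); last by ring.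
  rewrite ler_wpM2l ?mulr_ge0 ?(ltW L0)// ler_wpM2l//; lra.
have h5 : A1 * v <= A1 * (t * v) by rewrite ler_wpM2l.
have h6 : A2 * u <= A2 * (t * v) by rewrite ler_wpM2l// (le_trans uv).
have h7 := lerD (lerD (le_trans h1 h4) (le_trans h2 h5)) (le_trans h3 h6).
rewrite -[leRHS]mulrA ler_wpM2l//; apply: (le_trans h7).
by rewrite -!mulrDl.
Qed.

End exponential_bounds.

Theorem theorem2p5 (R : realType) (tau omega iota p : R)
    (tau_gt0 : 0 < tau) (omega_ge1 : 1 <= omega) (p_ge1 : 1 <= p) :
  exists c c' : R, [/\ 0 < c, 0 < c' &
    forall (X Y : hilbertType R) (B L sigma a b : R)
      (mu : probability (borel X) R) (lam : nat -> R) (phi : nat -> X)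
      (gamma : probability (borel Y) R),
      separable X -> separable Y ->
      0 < B -> 0 < L -> 0 < sigma ->
      cond_i mu ->
      cond_ii mu lam phi ->
      cond_iii_lower mu lam phi a b -> iota = 2 * a * b ->
      cond_iii_upper mu lam phi p ->
      gaussian_noise gamma ->
      (forall i, lam i = expR (- (tau * i.+1%:R `^ omega))) ->
      let rate := fun m : nat =>
        (ln (m%:R / sigma ^+ 2) `^ (omega / (omega + 1)))%:E in
      forall M : nat -> \bar R,
        M = fixed_design_risk mu gamma sigma p (lip_class B L) \/
        M = random_design_risk mu gamma sigma p (lip_class B L) ->
        lesssim c (neg_log_risk M) rate /\ lesssim c' rate (neg_log_risk M)].
Proof.
have p_gt0 : 0 < p := lt_le_trans ltr01 p_ge1.
pose delta := Num.min (tau / 6) 40^-1.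
have delta_gt0 : 0 < delta by rewrite lt_min divr_gt0//= invr_gt0.
have rho_gt0 : 0 < delta / (2 * p) by rewrite divr_gt0// mulr_gt0.
exists (3 + tau / 2 * 2 `^ omega + 2 * `|ln (iota / 2)|), (delta / (2 * p))^-1.
split.
- by rewrite ltr_wpDr ?mulr_ge0// ltr_wpDr// mulr_ge0 ?powR_ge0// divr_ge0// ltW.
- by rewrite invr_gt0.
move=> X Y B L sigma a b mu lam phi gamma _ sY B0 L0 sigma0 mu_i mu_ii dens iotaE.
move=> _ noise lamE rate M HM.
have [y0 y0_unit] := gaussian_noise_unit noise.
have [_ [phio _] _ indep] := mu_ii.
have [a0 b0 _] := dens.
have phi_unit i : `|phi i| = 1.
  by apply/eqP; rewrite -(@eqrXn2 _ 2)// expr1n -inner_norm phio eqxx.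
have scales T : 1 <= T -> \forall m \near \oo, exists t : R,
    [/\ T <= t, (0 < m)%N, ln (m%:R / sigma ^+ 2) = t * t `^ omega &
        rate m = (t `^ omega)%:E].
  move=> T1; near=> m.
  have Tm : T `^ (omega + 1) <= ln (m%:R / sigma ^+ 2).
    by near: m; exact: log_sample_size.
  have l0 : 0 < ln (m%:R / sigma ^+ 2).
    by apply: lt_le_trans Tm; rewrite powR_gt0// (lt_le_trans ltr01).
  exists (ln (m%:R / sigma ^+ 2) `^ (omega + 1)^-1).
  have [rateE lE] := log_scales omega_ge1 l0; split => //.
  - exact: scale_ge.
  - by near: m; exact: nbhs_infty_gt.
  - by rewrite /rate rateE.
split.
  have [T T1 lower] :=
    lower_asymptotics tau_gt0 omega_ge1 p_ge1 B0 L0 a0 b0 sigma0 iotaE.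
  apply: filterS (scales T T1) => m [t [Tt m0 lE ->]].
  have [k [N [eta [Lam [k0 mk eta0 Lam0 [lamN etaB etaL le]]]]]] :=
    lower t m Tt m0 lE.
  have lamN' i : (i < N)%N -> Lam <= Num.sqrt (lam i).
    by move=> iN; rewrite lamE; exact: lamN.
  have := risk_lower_bound p_ge1 sY B0 L0 phi_unit indep dens y0_unit k0 mk eta0
    Lam0 lamN' etaB etaL HM.
  by rewrite -EFinM => Mm; apply: lne_le; apply: le_trans Mm; rewrite lee_fin.
have [S S0 muS] : exists2 S, 0 <= S & (\int[mu]_x (`|x : X| ^+ 2)%:E <= S%:E)%E.
  have [_ fin] := mu_i.
  exists (fine (\int[mu]_x (`|x : X| ^+ 2)%:E)); last first.
    by rewrite fineK// ge0_fin_numE// integral_ge0.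
  by rewrite fine_ge0// integral_ge0.
have [T T1 upper] :=
  upper_asymptotics tau_gt0 omega_ge1 p_ge1 B0 L0 sigma0 S0.
apply: filterS (scales T T1) => m [t [Tt m0 lE ->]].
have [u [N [k [u0 le]]]] := upper t m Tt m0 lE.
have : ((delta / (2 * p) * t `^ omega)%:E <= neg_log_risk M m)%E.
  apply: lne_ge; apply: le_trans (risk_upper_bound p_ge1 sY B0 L0 sigma0 tau_gt0
    omega_ge1 mu_i mu_ii lamE noise N k u0 m0 muS HM) _.
  by rewrite lee_fin.
move=> /(lee_wpmul2l (x := ((delta / (2 * p))^-1)%:E)).
rewrite -EFinM mulrA mulVf ?gt_eqF// mul1r; apply.
by rewrite lee_fin invr_ge0 ltW.
Unshelve. all: by end_near. Qed.
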